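(* Let $\Phi$ be a finite NCIFS on $X\subset\mathbb R^d$ such that \[\limsup_{n\to\infty}\frac{\log\# I^{(n)}}{n}<\infty\qquad\text{and}\qquad\limsup_{n\to\infty}\frac{\log\rho_n}{n}<\infty.\] If $\operatorname{HD}(J(\Phi))=0$, then $B(\Phi)=0$. If $B(\Phi)=d$, then $\operatorname{HD}(J(\Phi))=d$.
   Context: Fix $d\in\mathbb N$ and a compact set $X\subset\mathbb R^d$ equal to the closure of its interior, such that $\partial X$ is smooth or $X$ is convex. $\|D\phi\|:=\sup_{x\in X}|\phi'(x)|$ for a conformal map $\phi$. An NCIFS $\Phi$ on $X$ is a sequence $\Phi^{(j)}=(\phi^{(j)}_i:X\to X)_{i\in I^{(j)}}$, $j\ge1$, of families indexed by finite or countably infinite sets, satisfying: - (open set condition) images of $\operatorname{int}X$ under distinct maps of the same $\Phi^{(j)}$ are disjoint; - (conformality) there is an open connected $V\supset X$ such that all maps extend to $C^1$ conformal diffeomorphisms of $V$ into $V$; - (bounded distortion) there is $K\ge1$ with $|\phi'(x)|\le K|\phi'(y)|$ for $x,y\in V$ and every composition $\phi=\phi^{(k)}_{\omega_k}\circ\cdots\circ\phi^{(l)}_{\omega_l}$, $k\le l$; - (uniform contraction) $\|D\phi^{(j)}_i\|\le\eta<1$ for all $i,j$. Finite means every $I^{(j)}$ is finite. For $\omega\in I^n=\prod_{j\le n}I^{(j)}$ let $\phi_\omega=\phi^{(1)}_{\omega_1}\circ\cdots\circ\phi^{(n)}_{\omega_n}$. Define $J(\Phi)=\bigcap_n\bigcup_{\omega\in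 I^n}\phi_\omega(X)$, $Z_n(t)=\sum_{\omega\in I^n}\|D\phi_\omega\|^t$, $\underline P(t)=\liminf_n\frac1n\log Z_n(t)$ and $B(\Phi)=\sup\{t\ge0:\underline P(t)>0\}$ (with $\sup\emptyset=0$). $\rho_n=\max_{a,b\in I^{(n)}}\|D\phi^{(n)}_a\|/\|D\phi^{(n)}_b\|$. $\operatorname{HD}$ is Hausdorff dimension. *)

(* Defs.v *)
(* Points of R^d are row vectors 'rV[R]_d
   over an arbitrary R : realType; metric notions (norm of derivatives,
   diameters) use the Euclidean norm [enorm].  The topology of 'rV[R]_d in the
   library comes from the sup-norm, which induces the same topology (and the
   same notion of differentiability) as the Euclidean norm. *)
From HB Require Import structures.
From mathcomp Require Import all_boot all_order all_algebra.
From mathcomp Require Import all_classical all_reals all_analysis.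
Set Implicit Arguments. Unset Strict Implicit. Unset Printing Implicit Defensive.
Import Order.TTheory GRing.Theory Num.Theory.
Import numFieldNormedType.Exports.
Local Open Scope classical_set_scope.
Local Open Scope ring_scope.

Section NCIFS_defs.
Variables (R : realType) (d : nat).
Local Notation E := 'rV[R]_d.

Definition enorm (v : E) : R := Num.sqrt (\sum_(i < d) v ord0 i ^+ 2).

Definition dnorm (f : E -> E) (x : E) : R :=
  sup [set enorm ('d f x v) | v in [set v : E | enorm v <= 1]].

Definition Dnorm (X : set E) (f : E -> E) : R := sup [set dnorm f x | x in X].

Definition conformal_C1_diffeo (V : set E) (f : E -> E) : Prop :=
  [/\ (forall x, V x -> V (f x)),
      (forall x, V x -> differentiable f x),
      (forall v : E, {within V, continuous (fun x => 'd f x v)}),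
      (forall x, V x -> exists2 c : R, 0 < c & forall v, enorm ('d f x v) = c * enorm v)
    & exists g : E -> E,
        [/\ (forall x, V x -> g (f x) = x),
            (forall y, (f @` V) y -> differentiable g y)
          & (forall v : E, {within f @` V, continuous (fun y => 'd g y v)})]].

Definition iter_D (vs : seq E) (g : E -> R) : E -> R :=
  foldr (fun v h => derive h ^~ v) g vs.

Definition smooth_on (W : set E) (g : E -> R) : Prop :=
  forall vs : seq E,
    (forall x v, W x -> derivable (iter_D vs g) x v) /\
    {within W, continuous (iter_D vs g)}.

Definition smooth_boundary (X : set E) : Prop :=
  forall p, (closure X `\` interior X) p ->
    exists W : set E, exists g : E -> R,
      [/\ open W, W p, smooth_on W g, (exists v : E, derive g p v != 0)
        & X `&` W = [set x | W x /\ g x <= 0]].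

Definition convex_set_E (X : set E) : Prop :=
  forall x y (t : R), X x -> X y -> 0 <= t <= 1 -> X ((1 - t) *: x + t *: y).

Definition admissible_X (X : set E) : Prop :=
  [/\ compact X, X = closure (interior X) & (smooth_boundary X \/ convex_set_E X)].

(** A finite NCIFS: level j >= 1 consists of the maps phi j i, i < N j
    (so I^(j) = {0,...,N j - 1}); level 0 is unused. *)
Definition comp_range (phi : nat -> nat -> E -> E) (k l : nat) (om : nat -> nat) : E -> E :=
  \big[(fun f g => f \o g)/(@id E)]_(k <= m < l.+1) phi m (om m).

Definition finite_NCIFS (X : set E) (N : nat -> nat) (phi : nat -> nat -> E -> E) : Prop :=
  [/\ (forall j, (1 <= j)%N -> (0 < N j)%N),
      (forall j i, (1 <= j)%N -> (i < N j)%N -> forall x, X x -> X (phi j i x)),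
      (forall j a b, (1 <= j)%N -> (a < N j)%N -> (b < N j)%N -> a != b ->
         phi j a @` interior X `&` phi j b @` interior X = set0),
      (exists V : set E,
         [/\ open V, connected V, X `<=` V,
             (forall j i, (1 <= j)%N -> (i < N j)%N -> conformal_C1_diffeo V (phi j i))
           &
             exists2 K : R, 1 <= K &
               forall k l (om : nat -> nat), (1 <= k)%N -> (k <= l)%N ->
                 (forall m, (k <= m <= l)%N -> (om m < N m)%N) ->
                 forall x y, V x -> V y ->
                   dnorm (comp_range phi k l om) x <= K * dnorm (comp_range phi k l om) y])
    &
      exists2 eta : R, eta < 1 &
        forall j i, (1 <= j)%N -> (i < N j)%N -> Dnorm X (phi j i) <= eta].

Definition word (N : nat -> nat) (n : nat) := {dffun forall j : 'I_n, 'I_(N j.+1)}.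

Definition phi_word (N : nat -> nat) (phi : nat -> nat -> E -> E) (n : nat)
    (w : word N n) : E -> E :=
  \big[(fun f g => f \o g)/(@id E)]_(j < n) phi j.+1 (w j).

Definition limit_set (X : set E) (N : nat -> nat) (phi : nat -> nat -> E -> E) : set E :=
  \bigcap_(n in [set: nat]) [set x | exists w : word N n, (phi_word phi w @` X) x].

Definition Zfun (X : set E) (N : nat -> nat) (phi : nat -> nat -> E -> E) (n : nat) (t : R) : R :=
  \sum_(w : word N n) (Dnorm X (phi_word phi w)) `^ t.

Definition lower_pressure X N phi (t : R) : \bar R :=
  limn_einf (fun n => ((ln (Zfun X N phi n t)) / n%:R)%:E).

Definition Bowen_param X N phi : \bar R :=
  let S := [set t%:E | t in [set t : R | 0 <= t /\ (0 < lower_pressure X N phi t)%E]] in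
  if `[< S = set0 >] then 0%E else ereal_sup S.

Definition rho X (N : nat -> nat) (phi : nat -> nat -> E -> E) (n : nat) : R :=
  \big[Num.max/0]_(a < N n) \big[Num.max/0]_(b < N n)
     (Dnorm X (phi n a) / Dnorm X (phi n b)).

Definition ediam (U : set E) : \bar R :=
  ereal_sup [set r : \bar R | exists x y, [/\ U x, U y & r = (enorm (x - y))%:E]].

Definition hterm (s : R) (U : set E) : \bar R :=
  if `[< U = set0 >] then 0%E else ((fine (ediam U)) `^ s)%:E.

Definition hausdorff_content (s delta : R) (A : set E) : \bar R :=
  ereal_inf [set (\sum_(i <oo) hterm s (U i))%E | U in
    [set U : nat -> set E | A `<=` \bigcup_i U i /\ forall i, (ediam (U i) <= delta%:E)%E]].

(** H^s(A) = lim_{delta -> 0+} H^s_delta(A) = sup_{delta > 0} H^s_delta(A). *)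
Definition hausdorff_measure (s : R) (A : set E) : \bar R :=
  ereal_sup [set hausdorff_content s delta A | delta in [set delta : R | 0 < delta]].

Definition hausdorff_dim (A : set E) : \bar R :=
  ereal_inf [set s%:E | s in [set s : R | 0 <= s /\ hausdorff_measure s A = 0%E]].

End NCIFS_defs.

(* Main.v *)
(* Write D_w for the norm of the derivative of phi_w on X, and give the words of
   length n the weights D_w^t / Z_n(t).  By bounded distortion the words extending a
   prefix v of length k carry mass at most K^t D_v^t / Z_k(t), whatever n is.  Each
   phi_w(X) has diameter at most C D_w and contains a ball of radius c D_w, and these
   balls are disjoint for words of the same length, so at most C (b/a)^d words of a
   given length with a <= D_w <= b meet a set of diameter at most b.

   Cut every word at the first k with D_(w|k+1) <= r < D_(w|k).  Uniform contraction
   gives k <= log r / log eta, and packing scale by scale (scales r^(j/m), j < m) shows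
   that a set of diameter r meets at most C_m r^(-d/m) pieces with D_(w|k) > r.

   If P(t) > 0, so that Z_k(t) >= c e^(eps k), each such prefix v has mass at most
   C r^g with g > 0: either k is at least a multiple of log(1/r), or D_v <= r^(1/2), or
   all maps of level k+1 contract by about rho_(k+1) r^(1/2), which forces Z_k(t) to be
   large because Z_(k+1)(t) is bounded below.

   If B = d, then Z_k(t) >= c for every t < d.  Packing the pieces of size at most r at
   the scales r^(1+j/m) gives mass at most C r^(t - (d+1)/m - M(d-t)) with M depending only
   on the growth of #I^(n) and on eta, and this exponent tends to d as t -> d, m -> oo.

   In both cases the mass distribution principle bounds the dimension below. *)
Require Import Defs.
From HB Require Import structures.
From mathcomp Require Import all_boot all_order all_algebra.
From mathcomp Require Import all_classical all_reals all_analysis.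
From mathcomp Require Import ring lra.
Set Implicit Arguments. Unset Strict Implicit. Unset Printing Implicit Defensive.
Import Order.TTheory GRing.Theory Num.Theory.
Import numFieldNormedType.Exports.
Local Open Scope classical_set_scope.
Local Open Scope ring_scope.

(** * Euclidean norm *)

Section EuclideanNorm.
Variables (R : realType) (d : nat).
Local Notation E := 'rV[R]_d.
Implicit Types u v w x y : E.

Definition edot u v : R := \sum_(i < d) u ord0 i * v ord0 i.

Lemma enorm_ge0 v : 0 <= enorm v.
Proof. exact: sqrtr_ge0. Qed.

Lemma enorm_sqr v : enorm v ^+ 2 = edot v v.
Proof.
rewrite /enorm sqr_sqrtr; last by apply: sumr_ge0 => i _; exact: sqr_ge0.
by apply: eq_bigr => i _; rewrite expr2.
Qed.

Lemma edotC u v : edot u v = edot v u.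
Proof. by apply: eq_bigr => i _; rewrite mulrC. Qed.

Lemma edotDl u v w : edot (u + v) w = edot u w + edot v w.
Proof. by rewrite -big_split; apply: eq_bigr => i _; rewrite !mxE mulrDl. Qed.

Lemma edotZl a u v : edot (a *: u) v = a * edot u v.
Proof. by rewrite mulr_sumr; apply: eq_bigr => i _; rewrite !mxE mulrA. Qed.

Lemma edotNl u v : edot (- u) v = - edot u v.
Proof. by rewrite -scaleN1r edotZl mulN1r. Qed.

Lemma edotBl u v w : edot (u - v) w = edot u w - edot v w.
Proof. by rewrite edotDl edotNl. Qed.

Lemma edotDr u v w : edot u (v + w) = edot u v + edot u w.
Proof. by rewrite edotC edotDl !(edotC u). Qed.

Lemma edotZr a u v : edot u (a *: v) = a * edot u v.
Proof. by rewrite edotC edotZl edotC. Qed.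

Lemma edot_ge0 u : 0 <= edot u u.
Proof. by rewrite -enorm_sqr sqr_ge0. Qed.

Lemma enorm0 : enorm (0 : E) = 0.
Proof. by rewrite /enorm big1 ?sqrtr0// => i _; rewrite mxE expr0n. Qed.

Lemma enormZ a v : enorm (a *: v) = `|a| * enorm v.
Proof.
apply/eqP; rewrite -(@eqrXn2 _ 2)// ?mulr_ge0 ?enorm_ge0//.
by rewrite exprMn !enorm_sqr edotZl edotZr mulrA real_normK ?num_real// expr2.
Qed.

Lemma enormN v : enorm (- v) = enorm v.
Proof. by rewrite -scaleN1r enormZ normrN1 mul1r. Qed.

Lemma enorm_distC u v : enorm (u - v) = enorm (v - u).
Proof. by rewrite -enormN opprB. Qed.

Lemma coord_le_enorm v i : `|v ord0 i| <= enorm v.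
Proof.
rewrite -(@ler_pXn2r _ 2)// ?nnegrE ?enorm_ge0// enorm_sqr real_normK ?num_real//.
rewrite /edot (bigD1 i)//= -expr2 lerDl.
by apply: sumr_ge0 => j _; rewrite -expr2 sqr_ge0.
Qed.

Lemma enorm_eq0 v : enorm v = 0 -> v = 0.
Proof.
move=> v0; apply/rowP => i; rewrite mxE; apply/eqP.
by rewrite -normr_le0 -v0 coord_le_enorm.
Qed.

Lemma enorm_gt0 v : v != 0 -> 0 < enorm v.
Proof.
by move=> v0; rewrite lt_neqAle enorm_ge0 andbT; apply: contra v0 => /eqP/esym/enorm_eq0 ->.
Qed.

Lemma edot_le u v : edot u v <= enorm u * enorm v.
Proof.
have [->|u0] := eqVneq u 0.
  by rewrite enorm0 mul0r /edot big1// => i _; rewrite mxE mul0r.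
have [->|v0] := eqVneq v 0.
  by rewrite enorm0 mulr0 /edot big1// => i _; rewrite mxE mulr0.
have := edot_ge0 (enorm v *: u - enorm u *: v).
rewrite !(edotDl, edotDr, edotNl, edotZl, edotZr) (edotC _ (- _)) (edotC _ (- _)).
rewrite !(edotDl, edotDr, edotNl, edotZl, edotZr) -!enorm_sqr (edotC v u).
move: (enorm_gt0 u0) (enorm_gt0 v0).
set a := enorm u; set b := enorm v => a0 b0 h.
have {}h : 0 <= (a * b) * (a * b - edot u v) by nra.
by rewrite pmulr_rge0 ?mulr_gt0// subr_ge0 in h.
Qed.

Lemma enormD u v : enorm (u + v) <= enorm u + enorm v.
Proof.
rewrite -(@ler_pXn2r _ 2)// ?nnegrE ?addr_ge0 ?enorm_ge0//.
rewrite enorm_sqr !(edotDl, edotDr) sqrrD !enorm_sqr (edotC v u).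
have := edot_le u v; lra.
Qed.

Lemma enormB_trans w u v : enorm (u - v) <= enorm (u - w) + enorm (w - v).
Proof. by apply: le_trans (enormD _ _); rewrite addrA subrK. Qed.

Lemma enorm_le_coord v a : (forall i, `|v ord0 i| <= a) -> enorm v <= d%:R * a.
Proof.
(* With [d = 0] the hypothesis is vacuous and [a] may be negative, hence the separate case. *)
move=> va; case: (posnP d) => [d0|d_gt0].
  rewrite /enorm big1 ?sqrtr0 ?d0 ?mul0r// => i _.
  by have := ltn_ord i; rewrite {2}d0.
have a0 : 0 <= a by apply: le_trans (va (Ordinal d_gt0)).
rewrite -(@ler_pXn2r _ 2)// ?nnegrE ?enorm_ge0 ?mulr_ge0//.
rewrite enorm_sqr; apply: (@le_trans _ _ (\sum_(i < d) a ^+ 2)).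
  apply: ler_sum => i _; rewrite -expr2 -[_ ^+ 2]real_normK ?num_real//.
  by rewrite lerXn2r// nnegrE.
rewrite sumr_const card_ord -[_ *+ d]mulr_natl exprMn; apply: ler_wpM2r; first exact: sqr_ge0.
by rewrite -natrX ler_nat -mulnn leq_pmulr.
Qed.

Lemma enorm_le_norm v : enorm v <= d%:R * `|v|.
Proof.
apply: enorm_le_coord => i; rewrite [leRHS]/Num.norm /= mx_normrE.
by apply/bigmax_geP; right => /=; exists (ord0, i).
Qed.

Lemma norm_le_enorm v : `|v| <= enorm v.
Proof.
rewrite [leLHS]/Num.norm /= mx_normrE; apply/bigmax_leP; split; first exact: enorm_ge0.
by move=> [i j] _ /=; rewrite ord1 coord_le_enorm.
Qed.

(** The link between the sup-norm topology and Euclidean balls, so that later neighbourhood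
    arguments can use Euclidean radii. *)
Lemma nbhs_enormP (x : E) (A : set E) :
  nbhs x A <-> exists2 r : R, 0 < r & forall y, enorm (y - x) < r -> A y.
Proof.
split=> [/nbhs_ballP[r /= r0 rA]|[r r0 rA]].
  exists r => // y xy; apply: rA; rewrite -ball_normE /= distrC.
  exact: le_lt_trans (norm_le_enorm _) xy.
(* [d.+1] in place of [d] keeps the radius positive when [d = 0]. *)
apply/nbhs_ballP; exists (r / d.+1%:R); first by rewrite /= divr_gt0.
move=> y; rewrite -ball_normE /= distrC => yx; apply: rA.
apply: le_lt_trans (enorm_le_norm _) _.
rewrite ltr_pdivlMr// mulrC in yx; apply: le_lt_trans yx.
by apply: ler_wpM2r => //; rewrite ler_nat.
Qed.

Lemma enorm_continuous (c : E) : continuous (fun x : E => enorm (x - c) : R).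
Proof.
move=> x; apply/(@cvgrPdist_lt _ _ _ (nbhs x) (nbhs_filter x)) => e e0.
apply/nbhs_enormP; exists e => // y yx.
apply: le_lt_trans yx; rewrite ler_norml.
have := enormB_trans y x c; have := enormB_trans x y c.
rewrite (enorm_distC x y); lra.
Qed.

End EuclideanNorm.

(** * Similarity derivatives *)

Section Calculus.
Variables (R : realType) (d : nat).
Local Notation E := 'rV[R]_d.
Implicit Types (f g : E -> E) (x y v : E) (V X : set E).

Lemma diff_approx f x v (e : R) : differentiable f x -> 0 < e ->
  exists2 h0 : R, 0 < h0 & forall h, 0 < `|h| < h0 ->
    enorm (h^-1 *: (f (h *: v + x) - f x) - 'd f x v) < e.
Proof.
move=> fx e0; have := @diff_derivable _ _ _ f x v fx.
rewrite /derivable -/('D_v f x) deriveE// => cv.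
have : (\forall h \near (0 : R)^', enorm ('d f x v - h^-1 *: (f (h *: v + x) - f x)) < e).
  have d0 : (0 : R) < d.+1%:R by [].
  move/cvgrPdist_lt : cv => /(_ (e / d.+1%:R) (divr_gt0 e0 d0)).
  apply: filterS => h /= hh; apply: le_lt_trans (enorm_le_norm _) _.
  rewrite ltr_pdivlMr// mulrC in hh; apply: le_lt_trans hh.
  by apply: ler_wpM2r => //; rewrite ler_nat.
move=> /nbhs_ballP[h0 /= h00 hh].
exists h0 => // h /andP[hp hl]; rewrite enorm_distC; apply: hh.
  by rewrite -ball_normE /= sub0r normrN.
by rewrite -normr_gt0.
Qed.

(** A positive ratio makes [l] injective, hence invertible on a finite-dimensional space. *)
Lemma conformal_surj (l : {linear E -> E}) (c : R) : 0 < c ->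
  (forall v, enorm (l v) = c * enorm v) -> forall w, exists v, l v = w.
Proof.
move=> c0 lc w.
have : row_free (lin1_mx l).
  apply: inj_row_free => v; rewrite mul_rV_lin1 => lv0.
  have := lc v; rewrite lv0 enorm0 => /esym/eqP; rewrite mulf_eq0 gt_eqF//=.
  by move=> /eqP/enorm_eq0.
rewrite row_free_unit => lu; exists (w *m invmx (lin1_mx l)).
by rewrite -mul_rV_lin1 mulmxKV.
Qed.

(* Ekeland-type argument replacing the inverse function theorem: a minimiser of
   |f x - y| + k |x - x0| on the ball solves f x = y, since otherwise a step along
   the preimage of y - f x under the derivative would decrease the functional. *)
Lemma conformal_image_ball f x0 y (r k : R) : 0 < k -> 0 < r ->
  (forall x, enorm (x - x0) <= r -> differentiable f x /\
     exists2 c, k < c & forall v, enorm ('d f x v) = c * enorm v) ->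
  enorm (y - f x0) < k * r ->
  exists2 x, enorm (x - x0) < r & f x = y.
Proof.
move=> k0 r0 fd yk.
pose B : set E := [set x | enorm (x - x0) <= r].
have cB : closed B.
  have -> : B = (fun x => enorm (x - x0)) @^-1` [set s : R | s <= r] by [].
  apply: preimage_closed; first by move=> x _; exact: enorm_continuous.
  exact: closed_le.
have bB : compact B.
  apply: bounded_closed_compact => //; exists (`|x0| + r); split; first exact: num_real.
  move=> M Mlt x Bx; apply/ltW; apply: le_lt_trans Mlt.
  have := norm_le_enorm (x - x0); have := ler_normD (x - x0) x0.
  rewrite subrK; move: Bx; rewrite /B /=; lra.
have B0 : B x0 by rewrite /B /= subrr enorm0 ltW.
pose h x := enorm (f x - y) + k * enorm (x - x0).
have [] := @compact_EVT_min _ _ h B _ bB; first by exists x0.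
  apply: continuous_in_subspaceT => x; rewrite inE => Bx.
  have [/differentiable_continuous fx _] := fd x Bx.
  apply: (@continuousD _ _ _ (fun x => enorm (f x - y)) (fun x => k * enorm (x - x0))).
    apply: (@continuous_comp _ _ _ f (fun z => enorm (z - y)) x); first exact: fx.
    exact: enorm_continuous.
  by apply: continuousM; [exact: cst_continuous|exact: enorm_continuous].
move=> z; rewrite inE => Bz zmin.
(* Comparison with the centre [x0], where the functional is below [k * r], puts the minimiser
   strictly inside the ball. *)
have zr : enorm (z - x0) < r.
  have := zmin x0; rewrite inE => /(_ B0); rewrite /h subrr enorm0 mulr0 addr0.
  rewrite (enorm_distC (f x0)) => hz.
  rewrite -(ltr_pM2l k0); apply: le_lt_trans yk; apply: le_trans hz.
  by rewrite lerDr enorm_ge0.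
exists z => //; apply/eqP; apply: contrapT => /negP fzy.
have [fz [c kc dfz]] := fd z Bz.
have e0 : 0 < enorm (f z - y) by rewrite enorm_gt0// subr_eq0.
have c0 : 0 < c by apply: lt_trans kc.
have [v vE] := conformal_surj c0 dfz (y - f z).
have vn : enorm v = enorm (f z - y) / c.
  by rewrite enorm_distC -vE dfz mulrAC divff ?mul1r// gt_eqF.
set e := enorm (f z - y) in e0 vn.
have kc1 : 0 < 1 - k / c by rewrite subr_gt0 ltr_pdivrMr// mul1r.
have [h0 h00 hh] := diff_approx v fz (mulr_gt0 e0 kc1).
have v0 : 0 < enorm v by rewrite vn divr_gt0.
(* The step is below [h0] for the linear approximation, at most 1 for the convex combination in
   [fE], and short enough to stay in the ball. *)
pose s := Num.min (h0 / 2) (Num.min 1 ((r - enorm (z - x0)) / (enorm v))).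
have s0 : 0 < s.
  by rewrite !lt_min divr_gt0//= ltr01/= divr_gt0// subr_gt0.
have sh0 : s < h0.
  by apply: (@le_lt_trans _ _ (h0 / 2)); [rewrite ge_min lexx|lra].
have s1 : s <= 1 by rewrite !ge_min lexx orbT.
have sv : s * enorm v <= r - enorm (z - x0).
  by rewrite -ler_pdivlMr// !ge_min lexx !orbT.
have nv : enorm (s *: v + z - x0) <= enorm (z - x0) + s * enorm v.
  by rewrite -addrA addrC; apply: le_trans (enormD _ _) _; rewrite enormZ (gtr0_norm s0).
have Bsv : B (s *: v + z) by rewrite /B /=; lra.
have := zmin (s *: v + z); rewrite inE => /(_ Bsv); rewrite /h -/e.
have /hh : 0 < `|s| < h0 by rewrite gtr0_norm// s0 sh0.
set q := _ *: _ - _ => qe.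
have fE : f (s *: v + z) - y = (1 - s) *: (f z - y) + s *: q.
  rewrite /q (scalerBr s) (scalerA s) divff ?gt_eqF// scale1r vE.
  by apply/rowP => i; rewrite !mxE; ring.
(* The first term of [h] drops by more than [s * e * (k / c)], while the second rises by at most
   [k * (s * enorm v)], the same amount; this contradicts minimality. *)
have : enorm (f (s *: v + z) - y) <= (1 - s) * e + s * enorm q.
  rewrite fE; apply: le_trans (enormD _ _) _; rewrite !enormZ (gtr0_norm s0).
  by rewrite ger0_norm ?subr_ge0.
have : s * enorm q < s * (e * (1 - k / c)) by rewrite ltr_pM2l.
have : k * (s * enorm v) = s * e * (k / c) by rewrite vn; ring.
have : k * enorm (s *: v + z - x0) <= k * (enorm (z - x0) + s * enorm v).
  by rewrite ler_pM2l.
nra.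
Qed.

(** The scalar mean value theorem is applied to the inner product of [f] along the segment with the
    fixed vector [f y - f x]; after Cauchy-Schwarz one factor of its norm cancels. *)
Lemma enorm_mean_value f x y (L : R) :
  (forall s : R, 0 <= s <= 1 -> differentiable f (s *: (y - x) + x) /\
    forall v, enorm ('d f (s *: (y - x) + x) v) <= L * enorm v) ->
  enorm (f y - f x) <= L * enorm (y - x).
Proof.
move=> fd; set e := f y - f x.
have [->|e0] := eqVneq e 0.
  rewrite enorm0; apply: le_trans (enorm_ge0 ('d f (0 *: (y - x) + x) (y - x))) _.
  by have [_] := fd 0 (introT andP (conj (lexx _) ler01)); exact.
pose g (s : R) := edot (f (s *: (y - x) + x)) e.
pose dg (s : R) := edot ('d f (s *: (y - x) + x) (y - x)) e.
have gd (s : R) : 0 <= s <= 1 -> is_derive s 1 g (dg s).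
  move=> /fd[fs _].
  have cv : h^-1 *: ((g \o shift s) (h *: (1 : R)) - g s) @[h --> 0^'] --> dg s.
    apply/cvgrPdist_lt => eps eps0.
    have := enorm_gt0 e0 => en0.
    have [h0 h00 hh] := diff_approx (y - x) fs (divr_gt0 eps0 en0).
    apply/nbhs_ballP; exists h0 => // h; rewrite -ball_normE /= sub0r normrN => hl hn.
    have /hh : 0 < `|h| < h0 by rewrite normr_gt0 hn.
    have E1 : (h *: (1 : R) + s) *: (y - x) + x = h *: (y - x) + (s *: (y - x) + x).
      by rewrite [h *: 1]mulr1 scalerDl addrA.
    rewrite /g /dg E1 distrC.
    have -> : h^-1 *: (edot (f (h *: (y - x) + (s *: (y - x) + x))) e -
          edot (f (s *: (y - x) + x)) e : R) = edot (h^-1 *: (f (h *: (y - x) + (s *: (y - x) + x)) - f (s *: (y - x) + x))) e.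
      by rewrite edotZl edotBl.
    rewrite -edotBl; set q := _ - _ => qe.
    have H : enorm q * enorm e < eps by rewrite -ltr_pdivlMr.
    rewrite ltr_norml; apply/andP; split.
      have := edot_le (- q) e; rewrite edotNl enormN; lra.
    by apply: le_lt_trans (edot_le _ _) _.
  by apply: DeriveDef; [apply/cvg_ex; exists (dg s)|exact/cvg_lim].
have [] := @MVT R g dg 0 1 ltr01.
- by move=> s; rewrite in_itv /= => /andP[/ltW s0 /ltW s1]; apply: gd; rewrite s0.
- apply: derivable_within_continuous => s; rewrite in_itv /= => /gd ds.
  exact: @ex_derive.
move=> s; rewrite in_itv /= => /andP[/ltW s0 /ltW s1].
rewrite /g /dg scale1r scale0r add0r subrK subr0 mulr1 -edotBl -/e => gE.
have [_ /(_ (y - x)) ds] := fd s (introT andP (conj s0 s1)).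
have := edot_le ('d f (s *: (y - x) + x) (y - x)) e; rewrite -gE -enorm_sqr => h.
rewrite -(ler_pM2r (enorm_gt0 e0)) -expr2; apply: le_trans h _.
by rewrite ler_pM2r ?enorm_gt0.
Qed.

(** One [C] serves every [f], so it plays the role of a path length from [x] to [y] inside [V]
    without choosing a path. *)
Definition lip_const V x (C : R) y := forall f (L : R), 0 <= L ->
  (forall z, V z -> differentiable f z /\ forall v, enorm ('d f z v) <= L * enorm v) ->
  enorm (f y - f x) <= C * L.

(** A ball inside [V] is convex, so the mean value inequality covers a move from or to its centre.
    The two directions give openness and closedness below. *)
Lemma lip_const_step V x C y z (r : R) : (forall w, enorm (w - y) < r -> V w) ->
  enorm (z - y) < r ->
  (lip_const V x C y -> lip_const V x (C + r) z) /\
  (lip_const V x C z -> lip_const V x (C + r) y).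
Proof.
move=> yV zy.
have H f L : 0 <= L -> (forall z, V z -> differentiable f z /\
    forall v, enorm ('d f z v) <= L * enorm v) -> enorm (f z - f y) <= r * L.
  move=> L0 fL; apply: (@le_trans _ _ (L * enorm (z - y))); last first.
    by rewrite mulrC ler_wpM2r// ltW.
  apply: enorm_mean_value => s /andP[s0 s1]; apply: fL; apply: yV.
  rewrite addrK enormZ ger0_norm//; apply: le_lt_trans zy.
  by rewrite ler_piMl// enorm_ge0.
split=> h f L L0 fL; have := h f L L0 fL; have := H f L L0 fL; rewrite mulrDl.
  have := enormB_trans (f y) (f z) (f x); lra.
have := enormB_trans (f z) (f y) (f x); rewrite (enorm_distC (f y) (f z)); lra.
Qed.

(** The points reachable from [x] at finite cost form a nonempty set that is open and closed in
    [V]. *)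
Lemma lip_const_connected V x : open V -> connected V -> V x ->
  forall y, V y -> exists C, lip_const V x C y.
Proof.
move=> oV cV Vx.
pose G := [set y | exists C, lip_const V x C y].
have loc y : V y -> exists2 r : R, 0 < r & forall z, enorm (z - y) < r -> V z.
  by move=> Vy; apply/nbhs_enormP; exact: open_nbhs_nbhs.
have VG : V `&` G = V.
  apply: cV.
  - exists x; split=> //; exists 0 => f L L0 fL; rewrite subrr enorm0 mul0r //.
  - exists (V `&` G); last by rewrite setIA setIid.
    rewrite openE => y [Vy [C yC]]; have [r r0 rV] := loc y Vy.
    apply/nbhs_enormP; exists r => // z zy; split; first exact: rV.
    by exists (C + r); have [/(_ yC)] := lip_const_step x C rV zy.
  - exists (~` (V `&` ~` G)).
      apply: open_closedC; rewrite openE => y [Vy yG]; have [r r0 rV] := loc y Vy.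
      apply/nbhs_enormP; exists r => // z zy; split; first exact: rV.
      move=> [C zC]; apply: yG; exists (C + r).
      by have [_ /(_ zC)] := lip_const_step x C rV zy.
    apply/seteqP; split=> z [Vz]; first by move=> Gz; split=> // -[].
    by move=> h; split=> //; apply: contrapT => zG; exact: h.
by move=> y Vy; have [] : (V `&` G) y by rewrite VG.
Qed.

(** [V] may fail to be convex; compactness of [X] makes the pointwise constants uniform. Applied to
    compositions of the system, this bounds the diameters of the pieces. *)
Lemma compact_lip_const V X : open V -> connected V -> X `<=` V -> compact X ->
  exists2 C : R, 0 < C & forall f (L : R), 0 <= L ->
  (forall z, V z -> differentiable f z /\ forall v, enorm ('d f z v) <= L * enorm v) ->
  forall x y, X x -> X y -> enorm (f x - f y) <= C * L.
Proof.
move=> oV cV XV cX.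
have [X0|/set0P[x Xx]] := eqVneq X set0.
  by exists 1 => // f L _ _ y z; rewrite X0.
have Vx := XV _ Xx.
have : \forall C \near +oo, X `<=` lip_const V x C.
  have /compact_near_coveringP := cX; apply => y /XV Vy.
  have [C yC] := lip_const_connected oV cV Vx Vy.
  have [r r0 rV] : exists2 r : R, 0 < r & forall z, enorm (z - y) < r -> V z.
    by apply/nbhs_enormP; exact: open_nbhs_nbhs.
  exists ([set z | enorm (z - y) < r], [set C' | C + r < C']).
    split; first by apply/nbhs_enormP; exists r.
    by exists (C + r); split; first exact: num_real.
  move=> [z C'] [/= zy CC'] f L L0 fL.
  have [/(_ yC) zC _] := lip_const_step x C rV zy.
  by apply: le_trans (zC f L L0 fL) _; rewrite ler_wpM2r// ltW.
move=> [C0 [_ hC]].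
pose C := Num.max 1 (C0 + 1).
have {}hC : X `<=` lip_const V x C by apply: hC; rewrite lt_max ltrDl ltr01 orbT.
exists (2 * C); first by rewrite mulr_gt0// lt_max ltr01.
move=> f L L0 fL y z Xy Xz.
have := hC y Xy f L L0 fL; have := hC z Xz f L L0 fL.
have := enormB_trans (f x) (f y) (f z); rewrite (enorm_distC (f x)); lra.
Qed.

End Calculus.

(** * Grids and conformal maps *)

Section GridCells.
Variables (R : realType) (d : nat).
Local Notation E := 'rV[R]_d.

(** The cube of side [2 * a] centred at [p] is cut into [m.+1] slabs along each axis; points of one
    cell differ by at most one slab width in every coordinate. *)
Lemma grid_cells (p : E) (a : R) (m : nat) : 0 < a ->
  exists cell : E -> {ffun 'I_d -> 'I_m.+1}, forall x y,
    enorm (x - p) <= a -> enorm (y - p) <= a -> cell x = cell y ->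
    enorm (x - y) <= d%:R * (2 * a / m.+1%:R).
Proof.
move=> a0; pose h := 2 * a / m.+1%:R.
have h0 : 0 < h by rewrite divr_gt0// mulr_gt0.
pose t (x : E) i := (x ord0 i - p ord0 i + a) / h.
(* Capping the index at [m] puts the far face of the cube into the last slab. *)
exists (fun x => [ffun i => inord (minn m (Num.truncn (t x i)))]) => x y xp yp.
have tb (z : E) i : enorm (z - p) <= a -> 0 <= t z i <= m.+1%:R.
  move=> /(le_trans (coord_le_enorm (z - p) i)); rewrite !mxE ler_norml => /andP[z1 z2].
  rewrite divr_ge0 ?(ltW h0)//=; last by lra.
  rewrite ler_pdivrMr// /h mulrCA divff ?pnatr_eq0// mulr1; lra.
move=> /ffunP xy; apply: enorm_le_coord => i.
have := xy i; rewrite !ffunE => /(congr1 val) /=; rewrite !inordK ?ltnS ?geq_minl//.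
have /andP[x0 x1] := tb x i xp; have /andP[y0 y1] := tb y i yp.
have fl (s : R) : 0 <= s <= m.+1%:R ->
    (minn m (Num.truncn s))%:R <= s <= (minn m (Num.truncn s))%:R + 1.
  move=> /andP[s0 s1]; have /andP[sl su] := truncn_itv s0.
  have [ms|ms] := leqP m (Num.truncn s).
    by rewrite natr1 s1 andbT; apply: le_trans sl; rewrite ler_nat.
  by rewrite sl natr1 ltW.
move=> e; have := fl _ (tb x i xp); have := fl _ (tb y i yp); rewrite e.
set n := (minn _ _)%:R => /andP[u1 u2] /andP[v1 v2].
have -> : (x - y) ord0 i = (t x i - t y i) * h.
  by rewrite /t -mulrBl mulfVK ?gt_eqF// !mxE; ring.
rewrite normrM (gtr0_norm h0); apply: ler_piMl; first exact: ltW.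
rewrite ler_norml; lra.
Qed.

(** Pigeonhole: the grid is so fine that two points of one cell are closer than [e], so distinct
    elements of [s] occupy distinct cells. *)
Lemma separated_card (T : eqType) (s : seq T) (c : T -> E) (p : E) (a e : R) :
  0 < a -> 0 < e -> uniq s ->
  (forall w, w \in s -> enorm (c w - p) <= a) ->
  (forall v w, v \in s -> w \in s -> v != w -> e <= enorm (c v - c w)) ->
  (size s)%:R <= (d%:R * (2 * a) / e + 1) ^+ d.
Proof.
move=> a0 e0 us sa se.
pose q := d%:R * (2 * a) / e.
have q0 : 0 <= q by rewrite divr_ge0 ?(ltW e0)// mulr_ge0// mulr_ge0// ltW.
have /andP[ql qu] := truncn_itv q0.
have [cell cellP] := grid_cells p (Num.truncn q) a0.
have inj : {in s &, injective (cell \o c)}.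
  move=> v w vs ws /= /(cellP _ _ (sa _ vs) (sa _ ws)) h.
  apply/eqP; apply: contraT => /(se _ _ vs ws) /le_trans /(_ h).
  rewrite mulrA ler_pdivlMr ?ltr0n// mulrC -ler_pdivlMr// -/q.
  by rewrite leNgt qu.
have : (size s <= (Num.truncn q).+1 ^ d)%N.
  have <- : #|{ffun 'I_d -> 'I_(Num.truncn q).+1}| = ((Num.truncn q).+1 ^ d)%N.
    by rewrite card_ffun !card_ord.
  rewrite -(size_map (cell \o c)) cardE; apply: uniq_leq_size.
    by rewrite map_inj_in_uniq.
  by move=> z _; rewrite mem_enum.
rewrite -(ler_nat R) natrX => /le_trans; apply; apply: lerXn2r.
- by rewrite nnegrE.
- by rewrite nnegrE addr_ge0.
- by rewrite -natr1 lerD2r.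
Qed.

End GridCells.

(** * Maps with similarity derivatives and their compositions *)

Section ConformalMaps.
Variables (R : realType) (d : nat).
Hypothesis d_gt0 : (0 < d)%N.
Local Notation E := 'rV[R]_d.

(** In positive dimension there is a unit vector, and it attains the supremum defining [dnorm]. *)
Lemma dnorm_similarity (f : E -> E) x (c : R) : 0 < c ->
  (forall v, enorm ('d f x v) = c * enorm v) -> dnorm f x = c.
Proof.
move=> c0 fc; rewrite /dnorm.
have ub : ubound [set enorm ('d f x v) | v in [set v : E | enorm v <= 1]] c.
  by move=> _ [v /= v1 <-]; rewrite fc ler_piMr// ltW.
pose e : E := delta_mx ord0 (Ordinal d_gt0).
have e0 : e != 0.
  apply/eqP => /rowP /(_ (Ordinal d_gt0)); rewrite !mxE !eqxx /= => /eqP.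
  by rewrite oner_eq0.
have inc : [set enorm ('d f x v) | v in [set v : E | enorm v <= 1]] c.
  have en := enorm_gt0 e0.
  have n1 : enorm ((enorm e)^-1 *: e) = 1.
    by rewrite enormZ ger0_norm ?invr_ge0 ?enorm_ge0// mulVf// gt_eqF.
  by exists ((enorm e)^-1 *: e); rewrite /= ?fc n1 ?mulr1.
apply/eqP; rewrite eq_le; apply/andP; split; first by apply: ge_sup => //; exists c.
by apply: ub_le_sup => //; exists c.
Qed.

(** The consequences of [conformal_C1_diffeo] that are carried through compositions, with
    [dnorm f x] named as the similarity ratio. *)
Definition conformal_map (V : set E) (f : E -> E) :=
  [/\ forall x, V x -> V (f x), forall x, V x -> differentiable f x,
      forall x, V x -> 0 < dnorm f x /\ forall v, enorm ('d f x v) = dnorm f x * enorm v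
    & forall x y, V x -> V y -> f x = f y -> x = y].

Lemma conformal_C1_diffeo_map (V : set E) f : conformal_C1_diffeo V f -> conformal_map V f.
Proof.
move=> [fV fd _ fc [g [gK _ _]]]; split=> //.
  move=> x /fc[c c0 fxc]; rewrite (dnorm_similarity c0 fxc) //.
by move=> x y Vx Vy fxy; rewrite -(gK x)// fxy gK.
Qed.

Lemma conformal_map_id (V : set E) : conformal_map V id.
Proof.
split=> // x _.
have h (v : E) : enorm ('d (@id E) x v) = 1 * enorm v.
  by rewrite diff_val mul1r.
by rewrite (dnorm_similarity ltr01 h).
Qed.

Lemma dnorm_id (x : E) : dnorm id x = 1.
Proof. by apply: dnorm_similarity => // v; rewrite diff_val mul1r. Qed.

Section Composition.
Variables (V : set E) (f g : E -> E).
Hypotheses (fP : conformal_map V f) (gP : conformal_map V g).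

Let comp_diff x : V x -> forall v,
  enorm ('d (f \o g) x v) = dnorm f (g x) * dnorm g x * enorm v.
Proof.
move=> Vx v; case: fP gP => fV fd fc _ [gV gd gc _].
have [_ gcx] := gc _ Vx; have [_ fcx] := fc _ (gV _ Vx).
have := diff_comp (gd _ Vx) (fd _ (gV _ Vx)) => /(congr1 (fun h => h v)) /= ->.
by rewrite fcx gcx mulrA.
Qed.

Lemma dnorm_comp x : V x -> dnorm (f \o g) x = dnorm f (g x) * dnorm g x.
Proof.
move=> Vx; apply: dnorm_similarity; last exact: comp_diff.
case: fP gP => fV fd fc _ [gV gd gc _].
by apply: mulr_gt0; [exact: (fc _ (gV _ Vx)).1|exact: (gc _ Vx).1].
Qed.

Lemma conformal_map_comp : conformal_map V (f \o g).
Proof.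
case: (fP) (gP) => fV fd fc fi [gV gd gc gi]; split.
- by move=> x Vx; exact/fV/gV.
- by move=> x Vx; apply: differentiable_comp; [exact: gd|exact/fd/gV].
- move=> x Vx; rewrite dnorm_comp//; split; last exact: comp_diff.
  by apply: mulr_gt0; [exact: (fc _ (gV _ Vx)).1|exact: (gc _ Vx).1].
- by move=> x y Vx Vy /fi xy; apply: gi => //; apply: xy; exact: gV.
Qed.

End Composition.
End ConformalMaps.

(** * Words and mass estimates *)

Section SumCover.
Variables (R : realType) (T : eqType).

(** Union bound: each [w] satisfying [P] is counted at least once on the right. *)
Lemma sum_cover (s : seq T) (P : pred T) (m : nat) (Q : nat -> pred T) (F : T -> R) :
  (forall w, w \in s -> 0 <= F w) ->
  (forall w, w \in s -> P w -> exists2 k, (k < m)%N & Q k w) ->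
  \sum_(w <- s | P w) F w <= \sum_(k < m) \sum_(w <- s | Q k w) F w.
Proof.
move=> F0 PQ; rewrite big_mkcond/=.
under [leRHS]eq_bigr do rewrite big_mkcond/=.
rewrite exchange_big/= big_seq [leRHS]big_seq; apply: ler_sum => w ws.
have S0 (k : 'I_m) : 0 <= if Q k w then F w else 0.
  by case: ifP => // _; exact: F0.
case: ifPn => [/(PQ w ws)[k km Qk]|_]; last exact: sumr_ge0.
rewrite (bigD1 (Ordinal km))//= Qk lerDl; apply: sumr_ge0 => i _; exact: S0.
Qed.

Lemma sum_le_size (s : seq T) (P : pred T) (F : T -> R) (a : R) :
  (forall w, w \in s -> P w -> F w <= a) ->
  \sum_(w <- s | P w) F w <= (size [seq w <- s | P w])%:R * a.
Proof.
move=> Fa; rewrite -big_filter.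
have -> : (size [seq w <- s | P w])%:R * a = \sum_(w <- [seq w <- s | P w]) a.
  by rewrite big_const_seq count_predT iter_addr_0 mulr_natl.
rewrite big_seq [leRHS]big_seq.
by apply: ler_sum => w; rewrite mem_filter => /andP[Pw ws]; exact: Fa.
Qed.

Lemma size_filter_sum (s : seq T) (P : pred T) :
  (size [seq w <- s | P w])%:R = \sum_(w <- s | P w) (1 : R).
Proof. by rewrite -big_filter -sum1_size natr_sum. Qed.

End SumCover.

Section Words.
Variable N : nat -> nat.

(* A word [v] at offset [k] lists indices for the levels k+1, ..., k + size v. *)
Fixpoint valid (k : nat) (v : seq nat) : bool :=
  if v is i :: v' then (i < N k.+1)%N && valid k.+1 v' else true.

Lemma valid_cat k u v : valid k (u ++ v) = valid k u && valid (k + size u) v.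
Proof.
elim: u k => [|i u IH] k /=; first by rewrite addn0.
by rewrite IH addSnnS andbA.
Qed.

Lemma valid_nth k v j : valid k v -> (j < size v)%N -> (nth 0%N v j < N (k + j).+1)%N.
Proof.
elim: v k j => [|i v IH] k [|j] //= /andP[iN vv].
  by rewrite addn0.
by rewrite ltnS => /(IH _ _ vv); rewrite addSnnS.
Qed.

Fixpoint words (k n : nat) : seq (seq nat) :=
  if n is n'.+1 then [seq i :: v | i <- iota 0 (N k.+1), v <- words k.+1 n']
  else [:: [::]].

Lemma mem_words k n v : (v \in words k n) = valid k v && (size v == n).
Proof.
elim: n k v => [|n IH] k v /=.
  by rewrite inE; case: v => //= i v; rewrite andbF.
apply/allpairsPdep/idP => [[i [u [iN]]]|].
  by rewrite IH => /andP[vu su] ->; move: iN; rewrite mem_iota add0n => /= ->; rewrite vu.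
case: v => //= i v /andP[/andP[iN vv] sv]; exists i, v.
by rewrite mem_iota add0n IH vv.
Qed.

Lemma words_uniq k n : uniq (words k n).
Proof.
elim: n k => // n IH k /=; apply: allpairs_uniq; rewrite ?iota_uniq//.
by move=> [i u] [j v] _ _ [-> ->].
Qed.

Lemma words_cat k a b : words k (a + b) = [seq u ++ v | u <- words k a, v <- words (k + a) b].
Proof.
elim: a k => [|a IH] k /=; first by rewrite addn0 cats0 map_id.
rewrite IH addSnnS; elim: (iota 0 _) => //= i l IHl.
rewrite IHl allpairs_cat; congr (_ ++ _).
by elim: (words k.+1 a) => //= u ws IHw; rewrite map_cat IHw -map_comp.
Qed.

End Words.
Arguments words : simpl never.

(** * Mass estimates for an abstract quasi-multiplicative weight [D] on words *)

Section Mass.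
Variables (R : realType) (N : nat -> nat) (D : nat -> seq nat -> R) (K eta : R).
Hypothesis K1 : 1 <= K.
Hypothesis D_gt0 : forall k v, valid N k v -> 0 < D k v.
Hypothesis D_nil : forall k, D k [::] = 1.
Hypothesis D_cat_le : forall k u v, valid N k (u ++ v) ->
  D k (u ++ v) <= D k u * D (k + size u) v.
Hypothesis D_cat_ge : forall k u v, valid N k (u ++ v) ->
  D k u * D (k + size u) v <= K * D k (u ++ v).
Hypotheses (eta0 : 0 < eta) (eta1 : eta < 1).
Hypothesis D_le_eta : forall k v, valid N k v -> D k v <= eta ^+ size v.

Let K0 : 0 < K. Proof. exact: lt_le_trans K1. Qed.

(** [Z_n(t)] for the system that starts after level [k]; the sums with [k > 0] are what remains when
    a prefix is split off. *)
Definition partition_sum (t : R) (k n : nat) : R := \sum_(w <- words N k n) D k w `^ t.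
Local Notation Z := partition_sum.

Lemma D_le1 k v : valid N k v -> D k v <= 1.
Proof. by move=> /D_le_eta h; apply: le_trans h _; apply: exprn_ile1; exact: ltW. Qed.

Lemma partition_sum_ge0 t k n : 0 <= Z t k n.
Proof. by apply: sumr_ge0 => w _; exact: powR_ge0. Qed.

Lemma powR_homo (a b t : R) : 0 <= t -> 0 <= a -> a <= b -> a `^ t <= b `^ t.
Proof. by move=> t0 a0 ab; apply: ge0_ler_powR => //; rewrite nnegrE// (le_trans a0). Qed.

Section FixedExponent.
Variable t : R.
Hypothesis t0 : 0 <= t.

Lemma extension_mass k n v : valid N 0 v -> size v = k ->
  \sum_(z <- words N k n) D 0 (v ++ z) `^ t <= D 0 v `^ t * Z t k n.
Proof.
move=> vv sv; rewrite mulr_sumr big_seq [leRHS]big_seq; apply: ler_sum => z.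
rewrite mem_words => /andP[vz _].
have vvz : valid N 0 (v ++ z) by rewrite valid_cat vv add0n sv.
rewrite -powRM ?(ltW (D_gt0 vv)) ?(ltW (D_gt0 vz))//; apply: powR_homo => //; first exact/ltW/D_gt0.
by have := D_cat_le vvz; rewrite add0n sv.
Qed.

Lemma partition_sum_cat_le k n : Z t 0 (k + n) <= Z t 0 k * Z t k n.
Proof.
rewrite /partition_sum words_cat big_allpairs_dep mulr_suml big_seq [leRHS]big_seq.
apply: ler_sum => v; rewrite mem_words add0n => /andP[vv /eqP sv].
exact: extension_mass.
Qed.

Lemma partition_sum_cat_ge k n : Z t 0 k * Z t k n <= K `^ t * Z t 0 (k + n).
Proof.
rewrite [Z t 0 (k + n)]/partition_sum words_cat big_allpairs_dep/= [leRHS]mulr_sumr.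
rewrite [Z t 0 k]/partition_sum mulr_suml.
rewrite big_seq [leRHS]big_seq; apply: ler_sum => v.
rewrite mem_words add0n => /andP[vv /eqP sv]; rewrite /partition_sum !mulr_sumr.
rewrite big_seq [leRHS]big_seq; apply: ler_sum => z.
rewrite mem_words => /andP[vz _].
have vvz : valid N 0 (v ++ z) by rewrite valid_cat vv add0n sv.
have pvz := ltW (D_gt0 vvz); have pv := ltW (D_gt0 vv); have pz := ltW (D_gt0 vz).
rewrite -!powRM//; last exact: ltW.
apply: powR_homo => //; first exact: mulr_ge0.
by have := D_cat_ge vvz; rewrite add0n sv.
Qed.

(** With denominators cleared: the normalised mass of [P] at length [n] is at most [K ^ t] times
    that of [Q] at length [k], uniformly in [n]. Submultiplicativity of [D] factors out the tail
    sum, and [partition_sum_cat_ge] removes it. *)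
Lemma prefix_mass (P Q : pred (seq nat)) k n : (k <= n)%N ->
  (forall u z, valid N 0 (u ++ z) -> size u = k -> P (u ++ z) -> Q u) ->
  (\sum_(w <- words N 0 n | P w) D 0 w `^ t) * Z t 0 k <=
  K `^ t * (\sum_(u <- words N 0 k | Q u) D 0 u `^ t) * Z t 0 n.
Proof.
move=> kn PQ.
have h : \sum_(w <- words N 0 n | P w) D 0 w `^ t <=
    (\sum_(u <- words N 0 k | Q u) D 0 u `^ t) * Z t k (n - k).
  rewrite -{1}(subnKC kn) words_cat big_mkcond big_allpairs_dep mulr_suml.
  rewrite [leRHS]big_mkcond big_seq [leRHS]big_seq; apply: ler_sum => v.
  rewrite mem_words add0n => /andP[vv /eqP sv].
  have [Qv|Qv] := ifPn.
    apply: le_trans (extension_mass (n - k) vv sv); apply: ler_sum => z _.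
    by case: ifP => // _; exact: powR_ge0.
  rewrite big_seq big1// => z; rewrite mem_words => /andP[vz _].
  case: ifP => // /PQ h; move: Qv; rewrite h//.
  by rewrite valid_cat vv add0n sv.
apply: le_trans (_ : (\sum_(u <- words N 0 k | Q u) D 0 u `^ t) *
                     (Z t 0 k * Z t k (n - k)) <= _).
  by rewrite mulrCA mulrC ler_wpM2l// partition_sum_ge0.
rewrite [leRHS]mulrAC [leRHS]mulrC; apply: ler_wpM2l.
  by apply: sumr_ge0 => u _; exact: powR_ge0.
by have := partition_sum_cat_ge k (n - k); rewrite (subnKC kn).
Qed.

End FixedExponent.

Variables (C1 : R) (d : nat).
Hypothesis C1_gt0 : 0 < C1.

(** [T] stands for the words whose pieces meet a set of diameter [r]. At scales [b >= r] that set is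
    no larger than the scale, so the count depends only on the ratio [b / a]. *)
Definition packs (T : pred (seq nat)) (r : R) :=
  forall n (a b : R) (s : seq (seq nat)), 0 < a -> a <= b -> r <= b -> uniq s ->
  (forall v, v \in s -> [/\ valid N 0 v, size v = n, a <= D 0 v <= b & T v]) ->
  (size s)%:R <= C1 * (b / a) ^+ d.

(** Take [j] to be the integer part of [m * ln x / ln r]. *)
Lemma scale_class (r x : R) (m : nat) : 0 < r < 1 -> (0 < m)%N -> 0 < x <= 1 ->
  exists j : nat, r `^ ((j%:R + 1) / m%:R) <= x <= r `^ (j%:R / m%:R).
Proof.
move=> /andP[r0 r1] m0 /andP[x0 x1].
have lr : ln r < 0 by apply: ln_lt0; rewrite r0.
pose y := ln x / ln r.
have xE : x = r `^ y.
  by rewrite /powR gt_eqF// /y mulfVK ?lt_eqF// lnK.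
have y0 : 0 <= y by rewrite /y -mulrNN -invrN divr_ge0// oppr_ge0 ?ln_le0 ?x1// ltW.
have m0' : 0 < m%:R :> R by rewrite ltr0n.
have /truncn_itv/andP[jl ju] : 0 <= y * m%:R by rewrite mulr_ge0.
exists (Num.truncn (y * m%:R)); rewrite {1 2}xE.
have r01 : 0 < r <= 1 by rewrite r0 ltW.
rewrite !ger_powR//; first by rewrite ler_pdivrMr.
by rewrite natr1 ler_pdivlMr// ltW.
Qed.

Lemma powR_div (r x y : R) : 0 < r -> r `^ x / r `^ y = r `^ (x - y).
Proof. by move=> r0; rewrite -powRN -powRD// (gt_eqF r0) implybT. Qed.

(** * Counting and mass at a fixed scale [r] *)

Section FixedScale.
Variables (T : pred (seq nat)) (r : R) (m : nat).
Hypotheses (r01 : 0 < r < 1) (Tr : packs T r) (m_gt0 : (0 < m)%N).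
Hypothesis T_cat : forall u v, valid N 0 (u ++ v) -> T (u ++ v) -> T u.

Let r0 : 0 < r. Proof. by case/andP: r01. Qed.
Let r1 : 0 < r <= 1. Proof. by case/andP: r01 => ->/ltW ->. Qed.
Let m0 : 0 < m%:R :> R. Proof. by rewrite ltr0n. Qed.
Let powr (x y : R) : r `^ (x + y) = r `^ x * r `^ y.
Proof. by rewrite powRD// (gt_eqF r0) implybT. Qed.

Let powr_exp (x : R) (n : nat) : (r `^ x) ^+ n = r `^ (x * n%:R).
Proof. by rewrite powRrM powR_mulrn// powR_ge0. Qed.

(** Each of the [m] scales between [r] and 1 has size ratio [r ^ (-1/m)], so each packing count
    loses only [r ^ (-d/m)]. *)
Lemma large_words_count k :
  (size [seq v <- words N 0 k | T v && (r < D 0 v)])%:R <=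
  m%:R * C1 * r `^ (- (d%:R / m%:R)).
Proof.
rewrite size_filter_sum.
pose Q j (v : seq nat) :=
  T v && (r `^ ((j%:R + 1) / m%:R) <= D 0 v <= r `^ (j%:R / m%:R)).
apply: le_trans (@sum_cover _ _ _ _ m Q _ _ _) _ => //.
  move=> v; rewrite mem_words => /andP[vv _] /andP[Tv rv].
  have [|j jv] := @scale_class r (D 0 v) m r01 m_gt0; first by rewrite D_gt0// D_le1.
  exists j; last by rewrite /Q Tv.
  (* [r < D 0 v] excludes the classes [j >= m]. *)
  rewrite ltnNge; apply: contraL rv => mj; rewrite -leNgt.
  have /andP[_ h] := jv; apply: le_trans h _.
  by rewrite -{2}(@powRr1 _ r (ltW r0)) ger_powR// ler_pdivlMr// mul1r ler_nat.
apply: le_trans (_ : \sum_(j < m) C1 * r `^ (- (d%:R / m%:R)) <= _); last first.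
  by rewrite sumr_const card_ord -[_ *+ m]mulr_natl mulrA.
apply: ler_sum => j _; rewrite -size_filter_sum.
have := @Tr k (r `^ ((j%:R + 1) / m%:R)) (r `^ (j%:R / m%:R))
  [seq w <- words N 0 k | Q j w].
rewrite powR_div// powr_exp -mulrBl.
have -> : (j%:R - (j%:R + 1)) / m%:R * d%:R = - (d%:R / m%:R) :> R by ring.
apply.
- exact: powR_gt0.
- by rewrite ger_powR// ler_pM2r ?invr_gt0// lerDl.
- rewrite -{1}(@powRr1 _ r (ltW r0)) ger_powR// ler_pdivrMr// mul1r ler_nat.
  exact/ltnW/ltn_ord.
- exact/filter_uniq/words_uniq.
- by move=> v; rewrite mem_filter mem_words => /andP[/andP[Tv jv] /andP[vv /eqP sv]].
Qed.

Lemma cut_mass (t : R) n Kx : eta ^+ Kx <= r -> (Kx <= n)%N ->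
  \sum_(w <- words N 0 n | T w) D 0 w `^ t <=
  \sum_(k < Kx) \sum_(w <- words N 0 n |
     [&& T w, r < D 0 (take k w) & D 0 (take k.+1 w) <= r]) D 0 w `^ t.
Proof.
move=> Kr Kn.
apply: (@sum_cover _ _ _ _ Kx
  (fun k w => [&& T w, r < D 0 (take k w) & D 0 (take k.+1 w) <= r])).
  by move=> w _; exact: powR_ge0.
move=> w; rewrite mem_words => /andP[vw /eqP sw] Tw.
have vt k : valid N 0 (take k w).
  by move: vw; rewrite -{1}(cat_take_drop k w) valid_cat => /andP[].
have ex : exists k, D 0 (take k w) <= r.
  exists Kx; apply: le_trans (D_le_eta (vt Kx)) _.
  by rewrite size_takel// sw.
(* The least index is positive because the empty word has weight [1 > r]; its predecessor is the cut
   level. *)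
have := ex_minnP ex; case=> -[|k] km kmin.
  by move: km; rewrite take0 D_nil leNgt; case/andP: r01 => _ ->.
exists k.
  apply: kmin; apply: le_trans (D_le_eta (vt Kx)) _.
  by rewrite size_takel// sw.
by rewrite Tw km andbT /= ltNge; apply/negP => /kmin; rewrite ltnn.
Qed.

Let lr : ln r < 0. Proof. by apply: ln_lt0. Qed.
Let leta : ln eta < 0. Proof. by apply: ln_lt0; rewrite eta0. Qed.

Let powrE (x : R) : r `^ x = expR (x * ln r).
Proof. by rewrite /powR gt_eqF. Qed.

(** Uniform contraction allows only about [ln r / ln eta] cut levels, and this logarithmic factor is
    absorbed into [r ^ (-1/m)]. *)
Lemma levels_mass (t B : R) n : ((Num.truncn (ln r / ln eta)).+1 <= n)%N -> 0 <= B ->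
  (forall k : nat, (k < n)%N -> k%:R <= ln r / ln eta ->
    \sum_(w <- words N 0 n |
      [&& T w, r < D 0 (take k w) & D 0 (take k.+1 w) <= r]) D 0 w `^ t <= B) ->
  \sum_(w <- words N 0 n | T w) D 0 w `^ t <=
    (m%:R / (- ln eta) + 1) * r `^ (- (1 / m%:R)) * B.
Proof.
move=> Kn B0 cutB; set Kx := (Num.truncn _).+1 in Kn.
have q0 : 0 <= ln r / ln eta by rewrite -mulrNN -invrN divr_ge0// oppr_ge0 ltW.
have /andP[ql qu] := truncn_itv q0.
have Kr : eta ^+ Kx <= r.
  rewrite -(lnK (x := eta))// -expRM_natl -[leRHS](lnK (x := r))// ler_expR.
  by rewrite -ler_ndivrMr// ltW.
apply: le_trans (cut_mass t Kr Kn) _.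
apply: le_trans (_ : \sum_(k < Kx) B <= _).
  apply: ler_sum => k _; apply: cutB; first exact: leq_trans (ltn_ord k) Kn.
  by apply: le_trans ql; rewrite ler_nat -ltnS ltn_ord.
rewrite sumr_const card_ord -[_ *+ Kx]mulr_natl; apply: ler_wpM2r => //.
(* [expR y] equals [r ^ (-1/m)], and it dominates both [y] and 1. *)
pose y := 1 / m%:R * - ln r.
have y0 : 0 <= y by rewrite mulr_ge0 ?divr_ge0// oppr_ge0 ltW.
have hy : 1 + y <= expR y by exact: expR_ge1Dx.
rewrite powrE; have -> : - (1 / m%:R) * ln r = y by rewrite /y mulNr mulrN.
have nl : 0 < - ln eta by rewrite oppr_gt0.
apply: (@le_trans _ _ (m%:R / (- ln eta) * y + 1)).
  rewrite /Kx -natr1 lerD2r; apply: le_trans ql _; rewrite /y.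
  by rewrite le_eqVlt; apply/orP; left; apply/eqP; field; rewrite gt_eqF//= lt_eqF.
rewrite mulrDl mul1r; apply: lerD; last by apply: le_trans hy; rewrite lerDl.
by apply: ler_wpM2l; [rewrite divr_ge0// ltW|apply: le_trans hy; rewrite lerDr].
Qed.

Section Growth.
Variables (A Cn : R).
Hypotheses (A0 : 0 < A) (Cn0 : 0 < Cn).
Hypothesis N_growth : forall j, (0 < j)%N -> (N j)%:R <= Cn * expR (A * j%:R).

Lemma size_words1 k : size (words N k 1) = N k.+1.
Proof. by rewrite /words size_allpairs size_iota muln1. Qed.

Lemma children_count k :
  (size [seq u <- words N 0 k.+1 | T u && (r < D 0 (take k u))])%:R <=
  m%:R * C1 * r `^ (- (d%:R / m%:R)) * (N k.+1)%:R.
Proof.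
apply: le_trans (_ : (size [seq v <- words N 0 k | T v && (r < D 0 v)])%:R * (N k.+1)%:R <= _).
  rewrite !size_filter_sum -addn1 words_cat big_mkcond big_allpairs_dep mulr_suml.
  rewrite [leRHS]big_mkcond [leLHS]big_seq [leRHS]big_seq; apply: ler_sum => v.
  rewrite mem_words add0n => /andP[vv /eqP sv].
  rewrite mul1r; have [Tv|Tv] := ifPn.
    rewrite addn1 -size_words1 -sum1_size natr_sum; apply: ler_sum => z _.
    by case: ifP.
  rewrite big_seq big1// => z; rewrite mem_words => /andP[vz _].
  rewrite take_size_cat//; case: ifP => // /andP[Tvz rv].
  by move: Tv; rewrite rv (T_cat _ Tvz)// valid_cat vv add0n sv.
by apply: ler_wpM2r => //; exact: large_words_count.
Qed.

(** Children of size between [r ^ (1+M)] and [r] are packed in classes of ratio [r ^ (1/m)]. Smaller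
    ones are counted crudely through their parents; [M] is large enough for their tiny weight to
    beat the growth of [N]. *)
Lemma children_mass (t : R) (M k : nat) : 0 < t -> t <= d%:R ->
  k%:R <= ln r / ln eta -> A <= M%:R * t * - ln eta ->
  \sum_(u <- words N 0 k.+1 | [&& T u, r < D 0 (take k u) & D 0 u <= r]) D 0 u `^ t <=
  ((M * m)%:R * C1 + m%:R * C1 * Cn * expR A) *
    r `^ (t - d%:R / m%:R - M%:R * (d%:R - t)).
Proof.
move=> t0 td kr AM; set J := (M * m)%N; set e := t - _ - _.
have JM : J%:R / m%:R = M%:R :> R by rewrite natrM mulfK// gt_eqF.
(* The last class [j = J] collects all children of size at most [r ^ (1+M)]. *)
pose Q j (u : seq nat) := if (j < J)%N
  then T u && (r `^ (1 + (j%:R + 1) / m%:R) <= D 0 u <= r `^ (1 + j%:R / m%:R))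
  else [&& T u, r < D 0 (take k u) & D 0 u <= r `^ (1 + M%:R)].
apply: le_trans (@sum_cover _ _ _ _ J.+1 Q _ _ _) _.
- by move=> w _; exact: powR_ge0.
- move=> u; rewrite mem_words => /andP[vu _] /and3P[Tu ru ur].
  have [|j /andP[j1 j2]] := @scale_class r (D 0 u / r) m r01 m_gt0.
    by rewrite divr_gt0 ?D_gt0//= ler_pdivrMr// mul1r.
  rewrite ler_pdivlMr// mulrC -{1}(@powRr1 _ r (ltW r0)) -powr in j1.
  rewrite ler_pdivrMr// mulrC -{1}(@powRr1 _ r (ltW r0)) -powr in j2.
  have [jJ|Jj] := ltnP j J; first by exists j; [rewrite ltnS ltnW|rewrite /Q jJ Tu j1].
  exists J => //; rewrite /Q ltnn Tu ru /=; apply: le_trans j2 _.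
  by rewrite ger_powR// lerD2l -JM ler_pM2r ?invr_gt0// ler_nat.
rewrite big_ord_recr /= mulrDl; apply: lerD.
  apply: le_trans (_ : \sum_(j < J) C1 * r `^ e <= _); last first.
    by rewrite sumr_const card_ord -[_ *+ J]mulr_natl mulrA.
  apply: ler_sum => j _; rewrite /Q ltn_ord.
  apply: le_trans (@sum_le_size _ _ _ _ _ (r `^ (t * (1 + j%:R / m%:R))) _) _.
    move=> u; rewrite mem_words => /andP[vu _] /andP[_ /andP[_ uj]].
    rewrite mulrC powRrM; apply: powR_homo => //; first exact: ltW.
    exact/ltW/D_gt0.
  set s := [seq _ <- _ | _].
  have : (size s)%:R <= C1 * (r / r `^ (1 + (j%:R + 1) / m%:R)) ^+ d.
    (* Packing is invoked with upper size [r], since [packs] speaks only of [b >= r]; class [j]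
       thereby loses [j / m * (d - t)] in the exponent. *)
    have cl : r `^ (1 + (j%:R + 1) / m%:R) <= r.
      by rewrite -{2}(@powRr1 _ r (ltW r0)) ger_powR// lerDl divr_ge0// addr_ge0.
    apply: (@Tr k.+1) => //; [exact: powR_gt0|exact/filter_uniq/words_uniq|].
    move=> u; rewrite mem_filter mem_words => /andP[/andP[Tu /andP[u1 u2]] /andP[vu /eqP su]].
    split=> //; rewrite u1 /=; apply: le_trans u2 _.
    by rewrite -{2}(@powRr1 _ r (ltW r0)) ger_powR// lerDl divr_ge0.
  rewrite -{1}(@powRr1 _ r (ltW r0)) powR_div// powr_exp => h.
  apply: le_trans (ler_wpM2r (powR_ge0 _ _) h) _.
  rewrite -mulrA -powr; apply: ler_wpM2l; first exact: ltW.
  rewrite ger_powR// /e -JM.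
  have jJ : j%:R <= J%:R :> R by rewrite ler_nat ltnW.
  have -> : (1 - (1 + (j%:R + 1) / m%:R)) * d%:R + t * (1 + j%:R / m%:R) =
    t - d%:R / m%:R - j%:R / m%:R * (d%:R - t) by ring.
  rewrite lerD2l lerN2; apply: ler_wpM2r; first by rewrite subr_ge0.
  by rewrite ler_pM2r ?invr_gt0.
rewrite /Q ltnn.
apply: le_trans (@sum_le_size _ _ _ _ _ (r `^ (t * (1 + M%:R))) _) _.
  move=> u; rewrite mem_words => /andP[vu _] /and3P[_ _ uj].
  rewrite mulrC powRrM; apply: powR_homo => //; first exact: ltW.
  exact/ltW/D_gt0.
apply: le_trans (ler_wpM2r (powR_ge0 _ _) (_ : _ <= m%:R * C1 *
   r `^ (- (d%:R / m%:R)) * (Cn * expR A * r `^ (- (M%:R * t))))) _.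
  apply: le_trans (_ : (size [seq u <- words N 0 k.+1 | T u && (r < D 0 (take k u))])%:R <= _).
    rewrite ler_nat !size_filter; apply: sub_count => u /and3P[-> -> _] //.
  apply: le_trans (children_count k) _; apply: ler_wpM2l.
    by rewrite mulr_ge0 ?powR_ge0// mulr_ge0// ltW.
  (* As [k <= ln r / ln eta], the choice of [M] bounds [expR (A * k)] by [r ^ (- M * t)]. *)
  apply: le_trans (N_growth _) _ => //; rewrite -mulrA; apply: ler_wpM2l; first exact: ltW.
  rewrite powrE -expRD ler_expR -natr1 mulrDr mulr1 addrC lerD2l.
  apply: le_trans (ler_wpM2l (ltW A0) kr) _.
  have q0 : 0 <= ln r / ln eta by rewrite -mulrNN -invrN divr_ge0// oppr_ge0 ltW.
  apply: le_trans (ler_wpM2r q0 AM) _.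
  rewrite le_eqVlt; apply/orP; left; apply/eqP; field.
  by rewrite lt_eqF.
rewrite -!mulrA; do 2! (apply: ler_wpM2l; first by rewrite ?ler0n ?ltW).
rewrite mulrCA; apply: ler_wpM2l; first exact: ltW.
rewrite mulrCA; apply: ler_wpM2l; first exact: expR_ge0.
rewrite -!powr ger_powR// /e.
have : 0 <= M%:R * (d%:R - t) by rewrite mulr_ge0// subr_ge0.
lra.
Qed.

(** The mass of a cut level is read off at the prefix of length [k.+1], where the partition sum is
    at least [c]; summing over the cut levels costs another [1 / m] in the exponent. *)
Lemma full_exponent_mass (t c : R) (M n : nat) : 0 < t -> t <= d%:R ->
  A <= M%:R * t * - ln eta -> 0 < c -> (forall k, c <= partition_sum t 0 k) ->
  ((Num.truncn (ln r / ln eta)).+1 <= n)%N ->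
  \sum_(w <- words N 0 n | T w) D 0 w `^ t <=
    (m%:R / (- ln eta) + 1) * (K `^ t / c *
    ((M * m)%:R * C1 + m%:R * C1 * Cn * expR A)) *
    r `^ (t - (d%:R + 1) / m%:R - M%:R * (d%:R - t)) * partition_sum t 0 n.
Proof.
move=> t0 td AM c0 cZ Kn.
set S := (M * m)%:R * C1 + _.
have S0 : 0 <= S.
  by rewrite addr_ge0// ?mulr_ge0 ?expR_ge0 ?ler0n ?(ltW C1_gt0) ?(ltW Cn0).
pose B := K `^ t / c * S * r `^ (t - d%:R / m%:R - M%:R * (d%:R - t)) * partition_sum t 0 n.
have B0 : 0 <= B.
  rewrite /B mulr_ge0 ?partition_sum_ge0// mulr_ge0 ?powR_ge0// mulr_ge0//.
  by rewrite divr_ge0 ?powR_ge0// ltW.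
apply: le_trans (levels_mass (t := t) Kn B0 _) _.
  move=> k kn kr.
  have := @prefix_mass t (ltW t0) (fun w => [&& T w, r < D 0 (take k w) & D 0 (take k.+1 w) <= r])
    (fun u => [&& T u, r < D 0 (take k u) & D 0 u <= r]) k.+1 n kn.
  move=> /(_ _)/= h.
  rewrite -(ler_pM2r c0).
  apply: le_trans (ler_wpM2l _ (cZ k.+1)) _.
    by apply: sumr_ge0 => w _; exact: powR_ge0.
  apply: le_trans (h _) _.
    move=> u z vuz su /and3P[Tuz ru ur]; rewrite (T_cat vuz Tuz) /=.
    by move: ru ur; rewrite take_cat su ltnSn take_size_cat// => -> ->.
  have := children_mass t0 td kr AM; rewrite -/S => hS.
  rewrite /B.
  have -> : K `^ t / c * S * r `^ (t - d%:R / m%:R - M%:R * (d%:R - t)) * partition_sum t 0 n * c =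
    K `^ t * (S * r `^ (t - d%:R / m%:R - M%:R * (d%:R - t))) * partition_sum t 0 n.
    by field; rewrite gt_eqF.
  apply: ler_wpM2r; first exact: partition_sum_ge0.
  by apply: ler_wpM2l => //; exact: powR_ge0.
rewrite /B le_eqVlt; apply/orP; left; apply/eqP.
have -> : t - (d%:R + 1) / m%:R - M%:R * (d%:R - t) =
    - (1 / m%:R) + (t - d%:R / m%:R - M%:R * (d%:R - t)) by ring.
by rewrite (powr (- (1 / m%:R))); ring.
Qed.

Variable Cr : R.
Hypothesis Cr0 : 0 < Cr.
Hypothesis ratio_growth : forall k i j, (i < N k.+1)%N -> (j < N k.+1)%N ->
  D k [:: j] <= Cr * expR (A * k.+1%:R) * D k [:: i].

(** The factor [r ^ g] is gained in one of three ways: from growth of the partition sum if [v] is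
    long, from the weight of [v] if it is at most [r ^ (1/2)], and otherwise from strong contraction
    of all maps of level [k.+1]. *)
Lemma thin_children_weight (t eps c g : R) (k : nat) (v : seq nat) (i : nat) :
  0 < t -> 0 < eps -> 0 < c -> (forall k, c * expR (eps * k%:R) <= partition_sum t 0 k) ->
  g <= t / 4 -> g <= eps * (t / (4 * A * (1 + t))) ->
  valid N 0 v -> size v = k -> (i < N k.+1)%N -> D 0 (rcons v i) <= r ->
  D 0 v `^ t <= (c^-1 + c^-1 * Cn * (Cr * K) `^ t * expR (A * (1 + t))) * r `^ g *
                partition_sum t 0 k.
Proof.
move=> t0 eps0 c0 cZ gt4 geps vv sv iN vir.
(* For [k] below [beta * - ln r] the factor [expR (A * (1 + t) * k)] is at most [r ^ (-t/4)], half
   of the gain [r ^ (t/2)] of the third case. *)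
set beta := t / (4 * A * (1 + t)) in geps.
have Z0 := partition_sum_ge0 t 0 k.
have ci0 : 0 < c^-1 by rewrite invr_gt0.
have rg : 0 <= r `^ g by exact: powR_ge0.
have C'0 : 0 <= c^-1 * Cn * (Cr * K) `^ t * expR (A * (1 + t)).
  by rewrite mulr_ge0 ?expR_ge0// mulr_ge0 ?powR_ge0// mulr_ge0// ltW.
have Zc j : c <= partition_sum t 0 j.
  apply: le_trans (cZ j); rewrite ler_peMr// ?(ltW c0)//.
  by rewrite -expR0 ler_expR mulr_ge0// ltW.
have D1 : D 0 v `^ t <= 1.
  have -> : (1 : R) = 1 `^ t by rewrite powR1.
  apply: powR_homo; [exact: ltW|exact/ltW/D_gt0|exact: D_le1].
have left_bound : D 0 v `^ t <= c^-1 * r `^ g * partition_sum t 0 k ->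
    D 0 v `^ t <= (c^-1 + c^-1 * Cn * (Cr * K) `^ t * expR (A * (1 + t))) * r `^ g *
                partition_sum t 0 k.
  by move=> h; apply: le_trans h _; rewrite mulrDl mulrDl lerDl mulr_ge0// mulr_ge0.
have [kb|kb] := lerP (beta * - ln r) k%:R.
  apply: left_bound; apply: le_trans D1 _.
  rewrite -mulrA -ler_pdivrMl// invrK mulr1.
  apply: le_trans (ler_wpM2l rg (cZ k)); rewrite mulrCA ler_peMr ?(ltW c0)//.
  rewrite powrE -expRD -[leLHS]expR0 ler_expR.
  have := ler_wpM2l (ltW eps0) kb; have := ler_wnM2r (ltW lr) geps.
  lra.
have [Dv|Dv] := lerP (D 0 v) (r `^ 2^-1).
  apply: left_bound; apply: (@le_trans _ _ (r `^ g)).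
    apply: le_trans (powR_homo (ltW t0) (ltW (D_gt0 vv)) Dv) _.
    by rewrite -powRrM ger_powR//; lra.
  by rewrite mulrAC ler_peMl// mulrC ler_pdivlMr// mul1r.
apply: le_trans (_ : c^-1 * Cn * (Cr * K) `^ t * expR (A * (1 + t)) * r `^ g *
     partition_sum t 0 k <= _); last first.
  by rewrite mulrDl mulrDl lerDr mulr_ge0// mulr_ge0// ltW.
apply: le_trans D1 _.
have vi : valid N 0 (v ++ [:: i]) by rewrite valid_cat vv /= add0n sv iN.
(* The child has weight at most [r] and the parent more than [r ^ (1/2)], so the last map alone must
   contract. *)
have Di : D k [:: i] <= K * r `^ 2^-1.
  have := D_cat_ge vi; rewrite add0n sv cats1 => h.
  have Di0 : 0 < D k [:: i] by rewrite D_gt0//= iN.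
  have hr : r = r `^ 2^-1 * r `^ 2^-1.
    by rewrite -powr -{1}(@powRr1 _ r (ltW r0)); congr (_ `^ _); lra.
  have p2 : 0 < r `^ 2^-1 by exact: powR_gt0.
  rewrite -(ler_pM2l p2) mulrCA -hr.
  apply: le_trans (_ : D 0 v * D k [:: i] <= _); first by rewrite ler_pM2r// ltW.
  by apply: le_trans h _; rewrite ler_pM2l.
(* By [ratio_growth], [F] bounds the weight of every letter of level [k.+1]. *)
pose F := Cr * expR (A * k.+1%:R) * (K * r `^ 2^-1).
have F0 : 0 <= F.
  by rewrite mulr_ge0// ?mulr_ge0 ?expR_ge0 ?powR_ge0 ?(ltW Cr0) ?(ltW K0).
have Z1 : partition_sum t k 1 <= (N k.+1)%:R * F `^ t.
  rewrite /partition_sum -size_words1 -{2}(filter_predT (words N k 1)).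
  apply: sum_le_size => z; rewrite mem_words => /andP[+ /eqP sz] _.
  case: z sz => [|j [|]]//= _ /andP[jN _].
  apply: powR_homo; [exact: ltW|by apply/ltW/D_gt0; rewrite /= jN|].
  apply: le_trans (ratio_growth iN jN) _; apply: ler_wpM2l => //.
  by rewrite mulr_ge0 ?expR_ge0// ltW.
(* The next partition sum is at least [c] but at most [Z_k] times a small factor, which forces [Z_k]
   to be large. *)
have cZk : c <= partition_sum t 0 k * ((N k.+1)%:R * F `^ t).
  apply: le_trans (Zc (k + 1)%N) _; apply: le_trans (partition_sum_cat_le (ltW t0) _ _) _.
  exact: ler_wpM2l.
have FE : F `^ t = (Cr * K) `^ t * (expR (A * k.+1%:R * t) * r `^ (t / 2)).
  have -> : F = (Cr * K) * (expR (A * k.+1%:R) * r `^ 2^-1) by rewrite /F; ring.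
  rewrite powRM ?mulr_ge0 ?expR_ge0 ?powR_ge0 ?(ltW Cr0) ?(ltW K0)//.
  by rewrite (powRM t (expR_ge0 _) (powR_ge0 _ _)) -powRrM (expRM _ t) (mulrC 2^-1).
have bound : (N k.+1)%:R * F `^ t <= Cn * (Cr * K) `^ t * expR (A * (1 + t)) * r `^ g.
  apply: le_trans (ler_wpM2r (powR_ge0 _ _) (N_growth (ltn0Sn k))) _.
  rewrite FE.
  have -> : Cn * expR (A * k.+1%:R) * ((Cr * K) `^ t * (expR (A * k.+1%:R * t) * r `^ (t / 2))) =
    Cn * (Cr * K) `^ t * (expR (A * k.+1%:R) * expR (A * k.+1%:R * t) * r `^ (t / 2)) by ring.
  rewrite -[leRHS]mulrA; apply: ler_wpM2l.
    by rewrite mulr_ge0 ?powR_ge0// ltW.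
  rewrite !powrE -!expRD ler_expR -natr1.
  have At : 0 < A * (1 + t) by rewrite mulr_gt0//; lra.
  have : A * (1 + t) * k%:R <= A * (1 + t) * (beta * - ln r) by rewrite ler_pM2l// ltW.
  have -> : A * (1 + t) * (beta * - ln r) = t / 4 * - ln r.
    by rewrite /beta; field; rewrite !gt_eqF//; lra.
  have : t / 4 * ln r <= g * ln r by rewrite ler_nM2r.
  lra.
have := le_trans cZk (ler_wpM2l Z0 bound); rewrite -(ler_pM2l ci0) mulVf ?gt_eqF// => h.
by apply: le_trans h _; rewrite le_eqVlt; apply/orP; left; apply/eqP; ring.
Qed.

(** Here the mass is read off at the parent, of length [k]: few prefixes exceed [r], and
    [thin_children_weight] bounds each of them. *)
Lemma positive_exponent_mass (t eps c g : R) (n : nat) :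
  0 < t -> 0 < eps -> 0 < c -> (forall k, c * expR (eps * k%:R) <= partition_sum t 0 k) ->
  g <= t / 4 -> g <= eps * (t / (4 * A * (1 + t))) ->
  ((Num.truncn (ln r / ln eta)).+1 <= n)%N ->
  \sum_(w <- words N 0 n | T w) D 0 w `^ t <=
    (m%:R / (- ln eta) + 1) * (K `^ t * (m%:R * C1) *
      (c^-1 + c^-1 * Cn * (Cr * K) `^ t * expR (A * (1 + t)))) *
    r `^ (g - (d%:R + 1) / m%:R) * partition_sum t 0 n.
Proof.
move=> t0 eps0 c0 cZ gt4 geps Kn.
set S := c^-1 + _.
have S0 : 0 <= S.
  rewrite addr_ge0// ?invr_ge0 ?(ltW c0)// mulr_ge0 ?expR_ge0// mulr_ge0 ?powR_ge0//.
  by rewrite mulr_ge0// ?invr_ge0 ltW.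
have mC0 : 0 <= m%:R * C1 by rewrite mulr_ge0// ltW.
have mCr : 0 <= m%:R * C1 * r `^ (- (d%:R / m%:R)) by rewrite mulr_ge0// powR_ge0.
have Sr : 0 <= S * r `^ g by rewrite mulr_ge0// powR_ge0.
pose B := K `^ t * (m%:R * C1 * r `^ (- (d%:R / m%:R))) * (S * r `^ g) * partition_sum t 0 n.
have B0 : 0 <= B.
  apply: mulr_ge0 (partition_sum_ge0 _ _ _); apply: mulr_ge0 => //.
  by apply: mulr_ge0 => //; exact: powR_ge0.
apply: le_trans (levels_mass (t := t) Kn B0 _) _.
  move=> k kn kr.
  have Zk : 0 < partition_sum t 0 k by apply: lt_le_trans (cZ k); rewrite mulr_gt0// expR_gt0.
  pose Q v := [&& T v, r < D 0 v & has (fun i => D 0 (rcons v i) <= r) (iota 0 (N k.+1))].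
  (* Membership in [words] is put into the predicate so that the word length is known: as [k < n],
     the part after the prefix is nonempty, and its first letter is the child required by [Q]. *)
  rewrite -(ler_pM2r Zk); apply: le_trans (_ : \sum_(w <- words N 0 n | (w \in words N 0 n) &&
      [&& T w, r < D 0 (take k w) & D 0 (take k.+1 w) <= r]) D 0 w `^ t * partition_sum t 0 k <= _).
    by rewrite -big_seq_cond mulr_suml.
  rewrite -mulr_suml.
  have := @prefix_mass t (ltW t0) (fun w => (w \in words N 0 n) &&
     [&& T w, r < D 0 (take k w) & D 0 (take k.+1 w) <= r]) Q k n (ltnW kn).
  move=> h; apply: le_trans (h _) _.
    move=> u z vuz su; rewrite mem_words => /andP[/andP[_ /eqP suz]].
    rewrite take_cat su ltnn subnn take0 cats0 => /and3P[Tuz ru].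
    case: z suz Tuz vuz => [|j z].
      by rewrite cats0 su => e; rewrite e ltnn in kn.
    move=> _ Tuz vuz; rewrite take_cat su ltnNge leqnSn /= subSnn /= take0 cats1 => uj.
    rewrite /Q (T_cat vuz Tuz) ru /=; apply/hasP; exists j => //.
    move: vuz; rewrite valid_cat add0n su /= => /and3P[_ jN _].
    by rewrite mem_iota.
  have hQ : \sum_(v <- words N 0 k | Q v) D 0 v `^ t <=
      m%:R * C1 * r `^ (- (d%:R / m%:R)) * (S * r `^ g * partition_sum t 0 k).
    apply: le_trans (@sum_le_size _ _ _ _ _ (S * r `^ g * partition_sum t 0 k) _) _.
      move=> v; rewrite mem_words => /andP[vv /eqP sv] /and3P[_ _ /hasP[i]].
      rewrite mem_iota add0n /= => iN ir.
      exact: (@thin_children_weight t eps c g k v i).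
    apply: ler_wpM2r; first by rewrite mulr_ge0// ltW.
    apply: le_trans (large_words_count k).
    by rewrite ler_nat !size_filter; apply: sub_count => v /and3P[-> ->].
  apply: le_trans (ler_wpM2r (partition_sum_ge0 _ _ _) (ler_wpM2l (powR_ge0 _ _) hQ)) _.
  by rewrite /B le_eqVlt; apply/orP; left; apply/eqP; ring.
rewrite /B le_eqVlt; apply/orP; left; apply/eqP.
have -> : g - (d%:R + 1) / m%:R = - (1 / m%:R) + (- (d%:R / m%:R) + g) by ring.
by rewrite (powr (- (1 / m%:R))) (powr (- (d%:R / m%:R))); ring.
Qed.

End Growth.
End FixedScale.

(** A discrete Frostman condition: under the weights [D ^ t / Z_n], the words meeting a set of
    diameter [r] have mass at most [C * r ^ s]. The threshold [n0] may depend on [r], because words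
    must be long enough to contain their cut. *)
Definition frostman (s : R) := exists t C : R,
  [/\ 0 < C, forall n, 0 < partition_sum t 0 n &
    forall (r : R) (T : pred (seq nat)), 0 < r < 1 -> packs T r ->
    (forall u v, valid N 0 (u ++ v) -> T (u ++ v) -> T u) ->
    exists n0, forall n, (n0 <= n)%N ->
      \sum_(w <- words N 0 n | T w) D 0 w `^ t <= C * r `^ s * partition_sum t 0 n].

Lemma ex_natr_ge (x : R) : exists2 m : nat, (0 < m)%N & x <= m%:R.
Proof.
exists (Num.truncn x).+1 => //; have [x0|/ltW x0] := lerP 0 x.
  by have /andP[_ /ltW] := truncn_itv x0.
exact: le_trans x0 _.
Qed.

Let powr_weaken (r e s B Zn : R) : 0 < r < 1 -> s <= e -> 0 <= B -> 0 <= Zn ->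
  B * r `^ e * Zn <= B * r `^ s * Zn.
Proof.
move=> /andP[r0 r1] se B0 Zn0; apply: ler_wpM2r => //; apply: ler_wpM2l => //.
by rewrite ger_powR// r0 ltW.
Qed.

(** * Choice of the parameters [m], [M] and [t] *)

Section GrowthConclusion.
Variables (A Cn : R).
Hypotheses (A0 : 0 < A) (Cn0 : 0 < Cn).
Hypothesis N_growth : forall j, (0 < j)%N -> (N j)%:R <= Cn * expR (A * j%:R).

Let nleta : 0 < - ln eta. Proof. by rewrite oppr_gt0 ln_lt0// eta0. Qed.

Lemma frostman_positive (Cr t eps c : R) : 0 < Cr ->
  (forall k i j, (i < N k.+1)%N -> (j < N k.+1)%N ->
    D k [:: j] <= Cr * expR (A * k.+1%:R) * D k [:: i]) ->
  0 < t -> 0 < eps -> 0 < c -> (forall k, c * expR (eps * k%:R) <= partition_sum t 0 k) ->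
  exists2 s : R, 0 < s & frostman s.
Proof.
move=> Cr0 ratio t0 eps0 c0 cZ.
pose g := Num.min (t / 4) (eps * (t / (4 * A * (1 + t)))).
have g0 : 0 < g.
  by rewrite lt_min divr_gt0//= mulr_gt0// divr_gt0// mulr_gt0 ?mulr_gt0//; lra.
(* Discretising the scales then costs at most half of [g]. *)
have [m m0 gm] := ex_natr_ge (2 * (d%:R + 1) / g).
have mg : (d%:R + 1) / m%:R <= g / 2.
  rewrite ler_pdivrMr ?ltr0n//; rewrite ler_pdivrMr// in gm; lra.
exists (g / 2); first by rewrite divr_gt0.
pose B := (m%:R / (- ln eta) + 1) * (K `^ t * (m%:R * C1) *
      (c^-1 + c^-1 * Cn * (Cr * K) `^ t * expR (A * (1 + t)))).
have B0 : 0 < B.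
  rewrite mulr_gt0//; first by rewrite addr_gt0// divr_gt0// ltr0n.
  rewrite mulr_gt0 ?mulr_gt0 ?powR_gt0 ?ltr0n// addr_gt0 ?invr_gt0//.
  by rewrite mulr_gt0 ?expR_gt0// mulr_gt0 ?powR_gt0 ?mulr_gt0// invr_gt0.
exists t, B; split => //.
  by move=> n; apply: lt_le_trans (cZ n); rewrite mulr_gt0 ?expR_gt0.
move=> r T r01 Tr Tcat; exists (Num.truncn (ln r / ln eta)).+1 => n nK.
apply: le_trans (_ : _ <= B * r `^ (g - (d%:R + 1) / m%:R) * partition_sum t 0 n) _.
  by apply: (positive_exponent_mass r01 _ m0 Tcat A0 Cn0 N_growth Cr0 ratio t0 eps0 c0 cZ) => //;
    rewrite ge_min lexx ?orbT.
by apply: powr_weaken; rewrite ?partition_sum_ge0 ?(ltW B0)//; lra.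
Qed.

Lemma frostman_full : (0 < d)%N ->
  (forall t, 0 <= t -> t < d%:R -> exists2 c : R, 0 < c & forall k, c <= partition_sum t 0 k) ->
  forall s, 0 <= s -> s < d%:R -> frostman s.
Proof.
move=> d0 cZ s s0 sd.
have d0' : 0 < d%:R :> R by rewrite ltr0n.
(* [M] is fixed before [t]: it suits every [t >= d / 2], so [t] may afterwards approach [d] without
   changing it. *)
have [M M0 AM] := ex_natr_ge (2 * A / (d%:R * - ln eta)).
have [m m0 gm] := ex_natr_ge (2 * (d%:R + 1) / (d%:R - s)).
have ds : 0 < d%:R - s by rewrite subr_gt0.
have mg : (d%:R + 1) / m%:R <= (d%:R - s) / 2.
  rewrite ler_pdivrMr ?ltr0n//; rewrite ler_pdivrMr// in gm; lra.
have M1 : 1 <= M%:R :> R by rewrite ler1n.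
(* With [t = d - x], the losses [x] and [M * x] together use half of [d - s]; the choice of [m]
   covers the other half. *)
pose x := (d%:R - s) / (2 * (1 + M%:R)).
have x0 : 0 < x by rewrite divr_gt0// mulr_gt0//; lra.
have xE : x * (1 + M%:R) = (d%:R - s) / 2 by rewrite /x; field; rewrite gt_eqF//; lra.
have xd : x <= d%:R / 2.
  have : x * 1 <= x * (1 + M%:R) by rewrite ler_pM2l//; lra.
  rewrite xE; lra.
pose t := d%:R - x.
have t0 : 0 < t by rewrite /t; lra.
have td : t < d%:R by rewrite /t; lra.
have AMt : A <= M%:R * t * - ln eta.
  rewrite ler_pdivrMr ?mulr_gt0// in AM.
  have : d%:R / 2 * (M%:R * - ln eta) <= t * (M%:R * - ln eta).
    by rewrite ler_pM2r ?mulr_gt0//; [rewrite /t; lra|lra].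
  lra.
have [c c0 cZt] := cZ t (ltW t0) td.
pose B := (m%:R / (- ln eta) + 1) * (K `^ t / c *
    ((M * m)%:R * C1 + m%:R * C1 * Cn * expR A)).
have B0 : 0 < B.
  rewrite mulr_gt0//; first by rewrite addr_gt0// divr_gt0// ltr0n.
  rewrite mulr_gt0 ?divr_gt0 ?powR_gt0// addr_gt0 ?mulr_gt0 ?expR_gt0 ?ltr0n//.
  by rewrite muln_gt0 M0.
exists t, B; split => //; first by move=> n; apply: lt_le_trans (cZt n).
move=> r T r01 Tr Tcat; exists (Num.truncn (ln r / ln eta)).+1 => n nK.
apply: le_trans (_ : _ <= B * r `^ (t - (d%:R + 1) / m%:R - M%:R * (d%:R - t)) *
                          partition_sum t 0 n) _.
  by apply: (full_exponent_mass r01 _ m0 Tcat A0 Cn0 N_growth t0 (ltW td) AMt c0 cZt).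
by apply: powr_weaken; rewrite ?partition_sum_ge0 ?(ltW B0)//; rewrite /t; lra.
Qed.

End GrowthConclusion.
End Mass.

(** * Hausdorff measure and dimension *)

Section Hausdorff.
Variables (R : realType) (d : nat).
Local Notation E := 'rV[R]_d.
Implicit Types (U A J X : set E) (s r : R).

Lemma hterm_ge0 s U : (0 <= hterm s U)%E.
Proof. by rewrite /hterm; case: ifP => // _; rewrite lee_fin powR_ge0. Qed.

Lemma ediam_le U r : (forall x y, U x -> U y -> enorm (x - y) <= r) ->
  (ediam U <= r%:E)%E.
Proof. by move=> Ur; apply: ge_ereal_sup => _ [x [y [Ux Uy ->]]]; rewrite lee_fin Ur. Qed.

Lemma ediam_fin U r : U !=set0 -> (ediam U <= r%:E)%E ->
  exists2 a : R, 0 <= a <= r & ediam U = a%:E /\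
    (forall x y, U x -> U y -> enorm (x - y) <= a).
Proof.
move=> [x Ux] Ur.
have le_diam y z : U y -> U z -> ((enorm (y - z))%:E <= ediam U)%E.
  by move=> Uy Uz; apply: ereal_sup_ubound; exists y, z.
have d0 : (0%:E <= ediam U)%E.
  by have := le_diam x x Ux Ux; rewrite subrr enorm0.
case E0 : (ediam U) Ur d0 => [a||]//; rewrite !lee_fin => ar a0.
exists a; first by rewrite a0.
by split=> // y z Uy Uz; have := le_diam y z Uy Uz; rewrite E0 lee_fin.
Qed.

Lemma hterm_le s U r : 0 <= s -> (forall x y, U x -> U y -> enorm (x - y) <= r) ->
  (hterm s U <= (r `^ s)%:E)%E.
Proof.
move=> s0 Ur; rewrite /hterm; case: asboolP => U0; first by rewrite lee_fin powR_ge0.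
have /set0P/ediam_fin /(_ (ediam_le Ur)) [a /andP[a0 ar] [-> _]] : U != set0 by apply/eqP.
by rewrite lee_fin /=; apply: powR_homo.
Qed.

Lemma hausdorff_content_ge0 s r A : (0 <= hausdorff_content s r A)%E.
Proof.
apply: le_ereal_inf_tmp => _ [U _ <-]; apply: nneseries_ge0 => n _ _.
exact: hterm_ge0.
Qed.

Lemma hausdorff_content_le_measure s r A : 0 < r ->
  (hausdorff_content s r A <= hausdorff_measure s A)%E.
Proof. by move=> r0; apply: ereal_sup_ubound; exists r. Qed.

Lemma hausdorff_measure_ge0 s A : (0 <= hausdorff_measure s A)%E.
Proof. exact: le_trans (hausdorff_content_ge0 s 1 A) (hausdorff_content_le_measure s A ltr01). Qed.

Lemma hausdorff_dim_ge0 A : (0 <= hausdorff_dim A)%E.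
Proof. by apply: le_ereal_inf_tmp => _ [s /= [s0 _] <-]; rewrite lee_fin. Qed.

(** A grid of [m ^ d] cells of diameter of order [1 / m] costs at most a constant times
    [m ^ (d - s)], which tends to 0. *)
Lemma hausdorff_measure_eq0 s A (p : E) (a : R) : d%:R < s -> 0 < a ->
  (forall x, A x -> enorm (x - p) <= a) -> hausdorff_measure s A = 0%E.
Proof.
move=> ds a0 Aa; apply/eqP; rewrite eq_le hausdorff_measure_ge0 andbT.
have s0 : 0 < s by apply: le_lt_trans ds.
have sd : 0 < s - d%:R by rewrite subr_gt0.
apply: ge_ereal_sup => _ [delta /= delta0 <-].
apply/lee_addgt0Pr => e e0; rewrite add0e.
pose c := (d.+1%:R * (2 * a)) `^ s.
have c0 : 0 < c by rewrite powR_gt0// !mulr_gt0.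
(* The first summand makes the cells smaller than [delta], the second brings the total cost below
   [e]. *)
have [m m0 mb] := ex_natr_ge (d%:R * (2 * a) / delta + (c / e) `^ (s - d%:R)^-1).
have m0' : 0 < m%:R :> R by rewrite ltr0n.
have md : d%:R * (2 * a) / delta <= m%:R.
  by apply: le_trans mb; rewrite lerDl powR_ge0.
have me : (c / e) `^ (s - d%:R)^-1 <= m%:R.
  apply: le_trans mb; rewrite lerDr divr_ge0 ?(ltW delta0)// mulr_ge0//.
  by rewrite mulr_ge0// ltW.
have [m' mE] : exists m', m = m'.+1 by case: (m) m0 => // m' _; exists m'.
have [cell cellP] := grid_cells p m' a0.
rewrite -mE in cell cellP.
pose h := d%:R * (2 * a / m%:R).
pose T := {ffun 'I_d -> 'I_m}.
pose U (i : nat) : set E := [set x | enorm (x - p) <= a /\ enum_rank (cell x) = i :> nat].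
have Ud i x y : U i x -> U i y -> enorm (x - y) <= h.
  by move=> [xp xi] [yp yi]; apply: cellP => //; apply/enum_rank_inj/val_inj; exact: etrans xi (esym yi).
apply: ge_ereal_inf; exists (\sum_(i <oo) hterm s (U i))%E.
  exists U => //; split.
    by move=> x /Aa xp; exists (enum_rank (cell x)).
  move=> i; apply: ediam_le => x y Ux Uy; apply: le_trans (Ud i x y Ux Uy) _.
  by rewrite /h mulrA ler_pdivrMr// -ler_pdivrMl// mulrC.
have U0 i : (#|T| <= i)%N -> U i = set0.
  move=> Ti; apply/seteqP; split => // x [_ xi]; move: Ti.
  by rewrite leqNgt; have := ltn_ord (enum_rank (cell x)); rewrite xi => ->.
rewrite (nneseries_split 0 #|T|); last by move=> k _; exact: hterm_ge0.
rewrite add0n (eseries0 (N := #|T|)) ?adde0; last first.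
  by move=> i Ti _; rewrite /hterm U0//; case: asboolP.
apply: (@le_trans _ _ (\sum_(0 <= k < #|T|) (h `^ s)%:E)%E).
  by apply: lee_sum => i _; apply: hterm_le; [exact: ltW|exact: Ud].
rewrite sumEFin lee_fin sumr_const_nat subn0 -[_ *+ _]mulr_natl.
rewrite card_ffun !card_ord natrX -powR_mulrn//.
have hc : h `^ s <= c * m%:R `^ (- s).
  have -> : m%:R `^ (- s) = m%:R^-1 `^ s by rewrite -mulN1r powRrM powR_inv1.
  rewrite -powRM ?mulr_ge0 ?invr_ge0 ?(ltW a0)//; apply: powR_homo; first exact: ltW.
    by rewrite /h !mulr_ge0 ?invr_ge0 ?(ltW a0).
  by rewrite /h mulrA ler_pM2r ?invr_gt0// ler_pM2r ?mulr_gt0// ler_nat.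
apply: le_trans (ler_wpM2l (powR_ge0 _ _) hc) _.
rewrite mulrCA -powRD; last by rewrite (gt_eqF m0') implybT.
have -> : d%:R - s = - (s - d%:R) by ring.
rewrite powRN ler_pdivrMr ?powR_gt0// mulrC -ler_pdivrMr//.
have ce : 0 <= c / e by rewrite divr_ge0 ?powR_ge0// ltW.
have -> : c / e = ((c / e) `^ (s - d%:R)^-1) `^ (s - d%:R).
  by rewrite -powRrM mulVf ?powRr1// lt0r_neq0.
by apply: powR_homo => //; [exact: ltW|exact: powR_ge0].
Qed.

Lemma hausdorff_dim_le A (p : E) (a : R) : 0 < a ->
  (forall x, A x -> enorm (x - p) <= a) -> (hausdorff_dim A <= d%:R%:E)%E.
Proof.
move=> a0 Aa; apply/lee_addgt0Pr => e e0; apply: ereal_inf_lbound.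
exists (d%:R + e) => //; split; first by rewrite addr_ge0// ltW.
by apply: (hausdorff_measure_eq0 (p := p) (a := a)) => //; rewrite ltrDl.
Qed.

(** * Thickened covers and the mass distribution principle *)

Definition thicken U r : set E := [set y | exists2 x, U x & enorm (y - x) < r].

Lemma thicken_sub U r : 0 < r -> U `<=` thicken U r.
Proof. by move=> r0 x Ux; exists x => //; rewrite subrr enorm0. Qed.

Lemma open_thicken U r : open (thicken U r).
Proof.
rewrite openE => y [x Ux yx]; apply/nbhs_enormP.
exists (r - enorm (y - x)); first by rewrite subr_gt0.
by move=> z zy; exists x => //; apply: le_lt_trans (enormB_trans y _ _) _; lra.
Qed.

Lemma thicken_diam U (a r : R) : (forall x y, U x -> U y -> enorm (x - y) <= a) ->
  forall x y, thicken U r x -> thicken U r y -> enorm (x - y) <= a + 2 * r.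
Proof.
move=> Ua x y [u Uu xu] [v Uv yv]; have := Ua u v Uu Uv.
have := enormB_trans u x y; have := enormB_trans v u y.
rewrite (enorm_distC v y); lra.
Qed.

Lemma thicken_cover s U (delta e : R) : 0 <= s -> 0 < delta -> delta < 1 -> 0 < e ->
  U !=set0 -> (ediam U <= (delta / 2)%:E)%E ->
  exists r rho : R, [/\ 0 < r, 0 < rho < 1,
    forall x y, thicken U r x -> thicken U r y -> enorm (x - y) <= rho
    & ((rho `^ s)%:E <= (2 `^ s)%:E * hterm s U + e%:E)%E].
Proof.
move=> s0 delta0 delta1 e0 U0 Ud.
have [a /andP[a0 ad] [Ua aP]] := ediam_fin U0 Ud.
have hE : hterm s U = (a `^ s)%:E.
  by rewrite /hterm; case: asboolP => [U0'|_]; [case: U0 => x; rewrite U0'|rewrite Ua].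
rewrite hE -EFinM -EFinD.
move: a0; rewrite le_eqVlt => /orP[/eqP a0|a0].
  (* At [s = 0] a point already has cost 1, because [0 ^ 0] is 1. *)
  have [s00|s0'] := eqVneq s 0.
    exists (1/4), (1/2); split.
    - lra.
    - by apply/andP; split; lra.
    - by move=> x y xU yU; apply: le_trans (thicken_diam aP xU yU) _; lra.
    - by rewrite lee_fin s00 !powRr0; lra.
  have s_gt0 : 0 < s by rewrite lt_neqAle eq_sym s0'.
  pose rho := Num.min (1 / 2) (e `^ s^-1).
  have p0 : 0 < e `^ s^-1 by exact: powR_gt0.
  have r0 : 0 < rho by rewrite lt_min p0 andbT; lra.
  have r1 : rho < 1 by apply: (@le_lt_trans _ _ (1 / 2)); [rewrite ge_min lexx|lra].
  exists (rho / 2), rho; split => //; first by lra.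
  - by rewrite r0.
  - by move=> x y xU yU; apply: le_trans (thicken_diam aP xU yU) _; lra.
  rewrite lee_fin -a0 powR0// mulr0 add0r.
  apply: (@le_trans _ _ ((e `^ s^-1) `^ s)).
    by apply: powR_homo => //; [exact: ltW|rewrite ge_min lexx orbT].
  by rewrite -powRrM mulVf// powRr1// ltW.
exists (a / 2), (2 * a); split; first by lra.
- by apply/andP; split; lra.
- by move=> x y xU yU; apply: le_trans (thicken_diam aP xU yU) _; lra.
by rewrite lee_fin powRM ?(ltW a0)// lerDl ltW.
Qed.

(* Mass distribution principle without a limit measure: [mu n] is the normalised
   mass of the pieces of generation n meeting a set.  By compactness finitely many
   thickened sets of a cover of J already cover [Xn n] for some large n. *)
Lemma mass_distribution X J (Xn : nat -> set E) (mu : nat -> set E -> R) (C s s' : R) :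
  compact X -> (forall n, closed (Xn n)) -> (forall n, Xn n `<=` X) ->
  (forall m n, (m <= n)%N -> Xn n `<=` Xn m) ->
  \bigcap_n Xn n `<=` J ->
  0 < C -> 0 <= s' -> s' <= s ->
  (forall n, mu n set0 = 0) ->
  (forall n m (U : nat -> set E), Xn n `<=` \bigcup_(i in [set i | (i < m)%N]) U i ->
     1 <= \sum_(i < m) mu n (U i)) ->
  (forall (U : set E) r, 0 < r < 1 -> (forall x y, U x -> U y -> enorm (x - y) <= r) ->
     exists n0, forall n, (n0 <= n)%N -> mu n U <= C * r `^ s) ->
  hausdorff_measure s' J <> 0%E.
Proof.
move=> cX clX XnX dX XJ C0 s0 ss mu0 muU muB HJ.
have delta4 : 0 < (1 / 4 : R) by lra.
pose L := (2 * C * 2 `^ s')^-1.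
have L0 : 0 < L by rewrite invr_gt0 !mulr_gt0// powR_gt0.
suff : (L%:E <= hausdorff_content s' (1/4) J)%E.
  move=> h; have := le_trans h (hausdorff_content_le_measure s' J delta4).
  by rewrite HJ lee_fin leNgt L0.
apply: le_ereal_inf_tmp => _ [U [JU Ud] <-].
(* Multiplied by [C], these errors sum to at most 1/2, which leaves mass at least 1/2 for the cover
   itself. *)
pose eps i : R := (2 * C)^-1 / 2 ^+ i.+1.
have eps0 i : 0 < eps i by rewrite divr_gt0 ?invr_gt0 ?mulr_gt0// exprn_gt0.
have thick i : exists rr : R * R, U i !=set0 -> [/\ 0 < rr.1, 0 < rr.2 < 1,
    forall x y, thicken (U i) rr.1 x -> thicken (U i) rr.1 y -> enorm (x - y) <= rr.2
    & ((rr.2 `^ s')%:E <= (2 `^ s')%:E * hterm s' (U i) + (eps i)%:E)%E].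
  have [U0|U0] := pselect (U i !=set0); last by exists (0, 0) => /U0.
  have Ud' : (ediam (U i) <= (1 / 2 / 2)%:E)%E by have -> : (1 / 2 / 2 : R) = 1 / 4 by lra.
  have h0 : 0 < (1 / 2 : R) by lra.
  have h1 : (1 / 2 : R) < 1 by lra.
  have [r [rho h]] := thicken_cover s0 h0 h1 (eps0 i) U0 Ud'.
  by exists (r, rho).
have {thick} [rr rrP] := choice thick.
pose U' i := thicken (U i) (rr i).1.
have UU' i : U i `<=` U' i.
  by move=> x Ux; have [r0 _ _ _] := rrP i (ex_intro _ x Ux); apply: thicken_sub.
(* A point of [X] outside some [Xn i] is caught by the open complement of [Xn i]; every other point
   lies in [J]. *)
have := cX; rewrite compact_cover => /(_ nat setT (fun i => U' i `|` ~` Xn i)) [].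
- move=> i _; apply: openU; first exact: open_thicken.
  exact: closed_openC.
- move=> x Xx; have [Jx|/existsNP[i Xix]] := pselect (forall n, Xn n x).
    have [|i _ Uix] := JU x; first by apply: XJ => i _.
    by exists i => //; left; exact: UU'.
  by exists i => //; right.
move=> D' _ XD'.
pose m := (\max_(i <- finmap.enum_fset D') i).+1.
have mD' i : i \in finmap.enum_fset D' -> (i < m)%N.
  by move=> iD; rewrite ltnS; apply: (@leq_bigmax_seq _ _ xpredT id i).
(* For [n >= m] the nested sets put [Xn n] inside each [Xn i] of the subcover, so the complements
   catch nothing. *)
have covn n : (m <= n)%N -> Xn n `<=` \bigcup_(i in [set i | (i < m)%N]) U' i.
  move=> mn x Xnx; have [i iD [Ux|]] := XD' x (XnX _ _ Xnx).
    by exists i => //; exact: mD'.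
  move=> []; apply: dX Xnx; apply: leq_trans mn; exact/ltnW/mD'.
have bnd i : exists n0, forall n, (n0 <= n)%N ->
    ((mu n (U' i))%:E <= C%:E * ((2 `^ s')%:E * hterm s' (U i) + (eps i)%:E))%E.
  have [U0|U0] := pselect (U i !=set0).
    have [r0 rho01 rhoP rhoh] := rrP i U0.
    have [n0 n0P] := muB (U' i) (rr i).2 rho01 rhoP.
    exists n0 => n /n0P h; apply: (@le_trans _ _ (C * (rr i).2 `^ s)%:E).
      by rewrite lee_fin.
    rewrite EFinM; apply: lee_wpmul2l; first by rewrite lee_fin ltW.
    apply: le_trans rhoh; rewrite lee_fin; case/andP: rho01 => h0 h1.
    by rewrite ger_powR// h0 ltW.
  exists 0%N => n _.
  have -> : U' i = set0.
    by apply/seteqP; split => // x [y Uy]; case: U0; exists y.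
  rewrite mu0 mule_ge0 ?lee_fin ?(ltW C0)//.
  by rewrite adde_ge0 ?lee_fin ?(ltW (eps0 _))// mule_ge0 ?hterm_ge0// lee_fin powR_ge0.
have {bnd} [n0 n0P] := choice bnd.
pose n := (maxn m (\max_(i < m) n0 i))%N.
have := muU n m U' (covn n (leq_maxl _ _)); rewrite -lee_fin -sumEFin => h1.
have h2 : (1%:E <= \sum_(i < m) C%:E * ((2 `^ s')%:E * hterm s' (U i) + (eps i)%:E))%E.
  apply: le_trans h1 _; apply: lee_sum => i _; apply: n0P.
  by apply: leq_trans (leq_maxr _ _); exact: leq_bigmax.
have epsS : \sum_(i < m) eps i <= (2 * C)^-1.
  rewrite -mulr_sumr; apply: ler_piMr; first by rewrite invr_ge0 mulr_ge0 ?(ltW C0).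
  suff -> : \sum_(i < m) (2 ^+ i.+1)^-1 = 1 - (2 ^+ m)^-1 :> R.
    by rewrite gerBl invr_ge0 exprn_ge0.
  elim: (m) => [|k IH]; first by rewrite big_ord0 expr0 invr1 subrr.
  by rewrite big_ord_recr /= IH exprS; field; rewrite expf_neq0.
have hfin i : hterm s' (U i) \is a fin_num by rewrite /hterm; case: ifP.
pose q i := fine (hterm s' (U i)).
have qE i : hterm s' (U i) = (q i)%:E by rewrite fineK.
apply: (@le_trans _ _ (\sum_(i < m) hterm s' (U i))%E); last first.
  rewrite -(big_mkord predT (fun i => hterm s' (U i))); apply: nneseries_lim_ge.
  by move=> i _ _; exact: hterm_ge0.
have hE i : (C%:E * ((2 `^ s')%:E * hterm s' (U i) + (eps i)%:E))%E =
    (C * (2 `^ s' * q i + eps i))%:E by rewrite qE.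
under eq_bigr do rewrite qE.
have {h2} : (1%:E <= \sum_(i < m) (C * (2 `^ s' * q i + eps i))%:E)%E.
  by apply: le_trans h2 _; apply: lee_sum => i _; rewrite hE.
rewrite !sumEFin !lee_fin -mulr_sumr big_split /= -mulr_sumr.
set S := \sum_(i < m) q i => h.
have C2 : C * (2 * C)^-1 = 1 / 2 by field; rewrite gt_eqF.
have : C * \sum_(i < m) eps i <= C * (2 * C)^-1 by rewrite ler_pM2l.
rewrite C2 => h'.
rewrite /L -[(_)^-1]mul1r ler_pdivrMr ?mulr_gt0 ?powR_gt0//; lra.
Qed.

End Hausdorff.

(** * Geometry of the system *)

Section System.
Variables (R : realType) (d : nat).
Local Notation E := 'rV[R]_d.
Variables (X V : set E) (N : nat -> nat) (phi : nat -> nat -> E -> E) (K eta : R).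

(** The head letter is the outermost map, of level [k.+1]; the offset makes the tail of a word a
    word again. *)
Fixpoint phi_seq (k : nat) (v : seq nat) : E -> E :=
  if v is i :: v' then phi k.+1 i \o phi_seq k.+1 v' else id.

Definition dn (k : nat) (v : seq nat) : R := Dnorm X (phi_seq k v).

Lemma phi_seq_cat k u v : phi_seq k (u ++ v) = phi_seq k u \o phi_seq (k + size u) v.
Proof.
elim: u k => [|i u IH] k /=; first by rewrite addn0.
by rewrite IH addSnnS compA.
Qed.

Lemma phi_seq_comp_range k v :
  phi_seq k v = \big[(fun f g => f \o g)/(@id E)]_(k.+1 <= m < (k + size v).+1)
    phi m (nth 0%N v (m - k.+1)).
Proof.
elim: v k => [|i v IH] k /=; first by rewrite addn0 big_geq.
rewrite big_ltn ?ltnS ?addnS ?leq_addr// subnn /=; congr (_ \o _).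
rewrite IH addSn big_nat [in RHS]big_nat; apply: eq_bigr => m /andP[km _].
by rewrite -(subnSK km).
Qed.

Hypothesis d_gt0 : (0 < d)%N.
Hypothesis phiX : forall j i, (1 <= j)%N -> (i < N j)%N -> forall x, X x -> X (phi j i x).
Hypothesis osc : forall j a b, (1 <= j)%N -> (a < N j)%N -> (b < N j)%N -> a != b ->
  phi j a @` interior X `&` phi j b @` interior X = set0.
Hypotheses (oV : open V) (cV : connected V) (XV : X `<=` V) (cX : compact X).
Hypothesis phiV : forall j i, (1 <= j)%N -> (i < N j)%N -> conformal_map V (phi j i).
Hypothesis K1 : 1 <= K.
Hypothesis distortion : forall k l (om : nat -> nat), (1 <= k)%N -> (k <= l)%N ->
  (forall m, (k <= m <= l)%N -> (om m < N m)%N) ->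
  forall x y, V x -> V y ->
    dnorm (comp_range phi k l om) x <= K * dnorm (comp_range phi k l om) y.
Hypothesis contraction : forall j i, (1 <= j)%N -> (i < N j)%N -> Dnorm X (phi j i) <= eta.
Variables (x0 : E) (r0 : R).
Hypotheses (r0_gt0 : 0 < r0) (x0_ball : forall x, enorm (x - x0) <= r0 -> interior X x).

Let K0 : 0 < K. Proof. exact: lt_le_trans K1. Qed.

Let intX : interior X x0.
Proof. by apply: x0_ball; rewrite subrr enorm0 ltW. Qed.

Let Xx0 : X x0. Proof. exact: interior_subset. Qed.

Lemma phi_seq_X k v x : valid N k v -> X x -> X (phi_seq k v x).
Proof. by elim: v k => [|i v IH] k //= /andP[iN vv] Xx; apply: phiX => //; exact: IH. Qed.

Lemma phi_seq_map k v : valid N k v -> conformal_map V (phi_seq k v).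
Proof.
elim: v k => [|i v IH] k /=; first by move=> _; exact: conformal_map_id.
by move=> /andP[iN vv]; apply: conformal_map_comp => //; [exact: phiV|exact: IH].
Qed.

Lemma dnorm_phi_seq_gt0 k v x : valid N k v -> V x -> 0 < dnorm (phi_seq k v) x.
Proof. by move=> /phi_seq_map[_ _ h _] /h[]. Qed.

Lemma phi_seq_distortion k v x y : valid N k v -> V x -> V y ->
  dnorm (phi_seq k v) x <= K * dnorm (phi_seq k v) y.
Proof.
(* The empty word is separate, since [distortion] speaks of compositions of at least one map. *)
move=> vv Vx Vy; case: v vv => [|i v] vv /=.
  by rewrite !dnorm_id ?mulr1.
have -> : phi k.+1 i \o phi_seq k.+1 v =
    comp_range phi k.+1 (k + size (i :: v)) (fun m => nth 0%N (i :: v) (m - k.+1)).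
  by rewrite -[LHS]/(phi_seq k (i :: v)) phi_seq_comp_range.
apply: distortion => //; first by rewrite /= addnS ltnS leq_addr.
move=> m /andP[km ml].
have := @valid_nth N k (i :: v) (m - k.+1) vv; rewrite -addSn subnKC//; apply.
by rewrite -(ltn_add2l k.+1) subnKC.
Qed.

Let dnorm_has_ub k v : valid N k v -> has_ubound [set dnorm (phi_seq k v) x | x in X].
Proof.
move=> vv; exists (K * dnorm (phi_seq k v) x0) => _ [x Xx <-].
by apply: phi_seq_distortion => //; exact: XV.
Qed.

Lemma dnorm_le_dn k v x : valid N k v -> X x -> dnorm (phi_seq k v) x <= dn k v.
Proof. by move=> vv Xx; apply: ub_le_sup; [exact: dnorm_has_ub|exists x]. Qed.

Lemma dn_le k v (a : R) :
  (forall x, X x -> dnorm (phi_seq k v) x <= a) -> dn k v <= a.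
Proof.
move=> h; apply: ge_sup; first by exists (dnorm (phi_seq k v) x0); exists x0.
by move=> _ [x Xx <-]; exact: h.
Qed.

Lemma dn_gt0 k v : valid N k v -> 0 < dn k v.
Proof.
move=> vv; apply: lt_le_trans (dnorm_le_dn vv Xx0).
by apply: dnorm_phi_seq_gt0 => //; exact: XV.
Qed.

Lemma dn_le_dnorm k v x : valid N k v -> V x -> dn k v <= K * dnorm (phi_seq k v) x.
Proof. by move=> vv Vx; apply: dn_le => y /XV Vy; exact: phi_seq_distortion. Qed.

Lemma dnorm_le_Kdn k v x : valid N k v -> V x -> dnorm (phi_seq k v) x <= K * dn k v.
Proof.
move=> vv Vx; apply: le_trans (phi_seq_distortion vv Vx (XV Xx0)) _.
by rewrite ler_pM2l// dnorm_le_dn.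
Qed.

Lemma dn_nil k : dn k [::] = 1.
Proof.
apply/eqP; rewrite eq_le; apply/andP; split.
  by apply: dn_le => x _; rewrite /= dnorm_id.
by rewrite -(dnorm_id d_gt0 x0); apply: (@dnorm_le_dn k [::]).
Qed.

Let dnorm_cat k u v x : valid N k (u ++ v) -> V x ->
  dnorm (phi_seq k (u ++ v)) x =
  dnorm (phi_seq k u) (phi_seq (k + size u) v x) * dnorm (phi_seq (k + size u) v) x.
Proof.
rewrite valid_cat => /andP[vu vv] Vx; rewrite phi_seq_cat (@dnorm_comp _ _ _ V)//;
  exact: phi_seq_map.
Qed.

Lemma dn_cat_le k u v : valid N k (u ++ v) -> dn k (u ++ v) <= dn k u * dn (k + size u) v.
Proof.
move=> uv; have := uv; rewrite valid_cat => /andP[vu vv].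
apply: dn_le => x Xx; rewrite dnorm_cat//; last exact: XV.
apply: ler_pM; rewrite ?dnorm_le_dn//; last exact: phi_seq_X.
  by apply/ltW/dnorm_phi_seq_gt0 => //; apply/XV/phi_seq_X.
by apply/ltW/dnorm_phi_seq_gt0 => //; exact: XV.
Qed.

(** By the chain rule and distortion, the derivative of the outer map at any image point is its
    supremum up to [K]. *)
Lemma dn_cat_ge k u v : valid N k (u ++ v) ->
  dn k u * dn (k + size u) v <= K * dn k (u ++ v).
Proof.
move=> uv; have := uv; rewrite valid_cat => /andP[vu vv].
rewrite -(ler_pdivlMl _ _ (dn_gt0 vu)); apply: dn_le => x Xx.
rewrite (ler_pdivlMl _ _ (dn_gt0 vu)).
have Vx := XV Xx; have gv := dnorm_phi_seq_gt0 vv Vx.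
have h1 := dnorm_le_dn uv Xx; rewrite (dnorm_cat uv Vx) in h1.
have h2 := dn_le_dnorm vu (XV (phi_seq_X vv Xx)).
apply: (@le_trans _ _ (K * dnorm (phi_seq k u) (phi_seq (k + size u) v x) *
                       dnorm (phi_seq (k + size u) v) x)).
  by apply: ler_wpM2r h2; exact: ltW.
by rewrite -mulrA; apply: ler_wpM2l h1; exact: ltW.
Qed.

Lemma dn_seq1 k i : dn k [:: i] = Dnorm X (phi k.+1 i).
Proof. by []. Qed.

Lemma dn_le_eta k v : valid N k v -> dn k v <= eta ^+ size v.
Proof.
elim: v k => [|i v IH] k; first by rewrite dn_nil.
move=> /[dup] vv /= /andP[iN vv'].
apply: le_trans (@dn_cat_le k [:: i] v vv) _; rewrite exprS addn1.
apply: ler_pM; [apply/ltW/dn_gt0|exact/ltW/dn_gt0| |exact: IH].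
  by rewrite /= iN.
by rewrite dn_seq1 contraction.
Qed.

(** The factor 2 puts [kappa] strictly below all derivative norms on [V], as [conformal_image_ball]
    demands. *)
Let kappa k v : R := dn k v / (2 * K).

Let kappa_gt0 k v : valid N k v -> 0 < kappa k v.
Proof. by move=> /dn_gt0 h; rewrite divr_gt0// mulr_gt0. Qed.

Let kappa_lt k v x : valid N k v -> V x -> kappa k v < dnorm (phi_seq k v) x.
Proof.
move=> vv Vx; rewrite /kappa ltr_pdivrMr ?mulr_gt0//.
have := dn_le_dnorm vv Vx; have := mulr_gt0 K0 (dnorm_phi_seq_gt0 vv Vx); lra.
Qed.

Let image_ball k v x y (r : R) : valid N k v -> 0 < r ->
  (forall z, enorm (z - x) <= r -> V z) -> enorm (y - phi_seq k v x) < kappa k v * r ->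
  exists2 z, enorm (z - x) < r & phi_seq k v z = y.
Proof.
move=> vv r_gt0 rV; apply: conformal_image_ball => //; first exact: kappa_gt0.
move=> z /rV Vz; case: (phi_seq_map vv) => _ hd hc _; split; first exact: hd.
by exists (dnorm (phi_seq k v) z); [exact: kappa_lt|have [] := hc _ Vz].
Qed.

Lemma phi_seq_interior k v x : valid N k v -> interior X x -> interior X (phi_seq k v x).
Proof.
move=> vv /nbhs_enormP[r r_gt0 rX]; apply/nbhs_enormP.
have r2 : 0 < r / 2 by lra.
exists (kappa k v * (r / 2)); first by rewrite mulr_gt0// kappa_gt0.
move=> y /image_ball -/(_ vv r2)[|z zx <-].
  by move=> z zx; apply/XV/rX; lra.
by apply: phi_seq_X => //; apply: rX; lra.
Qed.

(** Common leading letters cancel by injectivity; at the first difference the open set condition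
    applies, because the inner images stay in the interior. *)
Lemma phi_seq_interior_disjoint k u v x y : valid N k u -> valid N k v -> size u = size v ->
  interior X x -> interior X y -> phi_seq k u x = phi_seq k v y -> u = v.
Proof.
move=> vu vv suv ix iy; elim: u v k vu vv suv => [|i u IH] [|j v] k //=.
move=> /andP[iN vu] /andP[jN vv] [suv].
have [<-|ij] := eqVneq i j.
  have [_ _ _ inj] := phiV (isT : 1 <= k.+1)%N iN.
  move=> /inj e; congr (_ :: _); apply: (IH v k.+1) => //.
  by apply: e; apply/XV/phi_seq_X => //; exact: interior_subset.
move=> e; have := osc (isT : 1 <= k.+1)%N iN jN ij.
move=> /seteqP[/(_ (phi k.+1 i (phi_seq k.+1 u x)))] h _; exfalso; apply: h; split.
  by exists (phi_seq k.+1 u x) => //; exact: phi_seq_interior.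
by rewrite [X in _ X]e; exists (phi_seq k.+1 v y) => //; exact: phi_seq_interior.
Qed.

(** The ball of this radius about [phi_seq k u x0] lies in the image of the interior under
    [phi_seq k u], which cannot contain [phi_seq k v x0]. *)
Lemma phi_seq_separated k u v : valid N k u -> valid N k v -> size u = size v -> u != v ->
  r0 / (2 * K) * dn k u <= enorm (phi_seq k u x0 - phi_seq k v x0).
Proof.
move=> vu vv suv; apply: contraNT; rewrite -ltNge enorm_distC => h; apply/eqP.
have [] := @image_ball k u x0 (phi_seq k v x0) r0 vu r0_gt0.
- by move=> z /x0_ball/interior_subset/XV.
- by apply: lt_le_trans h _; rewrite /kappa le_eqVlt; apply/orP; left; apply/eqP; ring.
move=> z /ltW/x0_ball iz; exact: phi_seq_interior_disjoint.
Qed.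

Lemma phi_seq_diam : exists2 C : R, 0 < C & forall k v, valid N k v -> forall x y,
  X x -> X y -> enorm (phi_seq k v x - phi_seq k v y) <= C * dn k v.
Proof.
have [C C0 hC] := compact_lip_const oV cV XV cX.
exists (C * K); first exact: mulr_gt0.
move=> k v vv x y Xx Xy; rewrite -mulrA; apply: hC => //.
  by rewrite mulr_ge0 ?ltW// dn_gt0.
move=> z Vz; have [_ hd hc _] := phi_seq_map vv; split; first exact: hd.
move=> w; have [_ ->] := hc _ Vz; rewrite ler_wpM2r ?enorm_ge0//.
exact: dnorm_le_Kdn.
Qed.

(** * Packing of the pieces that meet a set *)

Definition touches (U : set E) (k : nat) (v : seq nat) : bool :=
  `[< exists2 x, X x & U (phi_seq k v x) >].

Lemma touches_cat U k u v : valid N k (u ++ v) -> touches U k (u ++ v) -> touches U k u.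
Proof.
rewrite valid_cat => /andP[vu vv] /asboolP[x Xx Ux]; apply/asboolP.
exists (phi_seq (k + size u) v x); first exact: phi_seq_X.
by move: Ux; rewrite phi_seq_cat.
Qed.

(** The points [phi_seq k v x0] lie within [(2 * C + 1) * b] of one another and are separated by a
    multiple of [a], so [separated_card] counts them. *)
Lemma packing : exists2 C : R, 0 < C & forall (U : set E) (k n : nat) (a b : R) (s : seq (seq nat)),
  0 < a -> a <= b -> (forall x y, U x -> U y -> enorm (x - y) <= b) -> uniq s ->
  (forall v, v \in s -> [/\ valid N k v, size v = n, a <= dn k v <= b & touches U k v]) ->
  (size s)%:R <= C * (b / a) ^+ d.
Proof.
have [C C0 hC] := phi_seq_diam.
pose q := d%:R * (2 * (2 * C + 1)) / (r0 / (2 * K)) + 1.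
have c0 : 0 < r0 / (2 * K) by rewrite divr_gt0// mulr_gt0.
have q0 : 0 < q.
  by apply: ltr_wpDl => //; rewrite divr_ge0// ?(ltW c0)// mulr_ge0//; lra.
exists (q ^+ d); first exact: exprn_gt0.
move=> U k n a b s a0 ab Ub us sP.
have b0 : 0 < b by apply: lt_le_trans ab.
case: s us sP => [|w s] us sP.
  by rewrite mulr_ge0// ?exprn_ge0// ?divr_ge0// ltW.
have near0 v : v \in w :: s -> exists2 y, U y & enorm (phi_seq k v x0 - y) <= C * b.
  move=> /sP[vv _ /andP[_ vb] /asboolP[x Xx Ux]].
  exists (phi_seq k v x) => //; apply: le_trans (hC _ _ vv _ _ Xx0 Xx) _.
  by rewrite ler_pM2l.
have [yw Uw ywP] := near0 w (mem_head _ _).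
have ball v : v \in w :: s -> enorm (phi_seq k v x0 - phi_seq k w x0) <= (2 * C + 1) * b.
  move=> /near0[y Uy yP].
  have := enormB_trans y (phi_seq k v x0) (phi_seq k w x0).
  have := enormB_trans yw y (phi_seq k w x0); rewrite (enorm_distC yw).
  have := Ub _ _ Uy Uw; lra.
have sep u v : u \in w :: s -> v \in w :: s -> u != v ->
    r0 / (2 * K) * a <= enorm (phi_seq k u x0 - phi_seq k v x0).
  move=> /sP[vu su /andP[ua _] _] /sP[vv sv _ _] uv.
  apply: le_trans (phi_seq_separated vu vv _ uv); last by rewrite su sv.
  by rewrite ler_pM2l.
have h1 : 0 < (2 * C + 1) * b by rewrite mulr_gt0//; lra.
apply: le_trans (separated_card h1 (mulr_gt0 c0 a0) us ball sep) _.
rewrite -exprMn; apply: lerXn2r; rewrite ?nnegrE.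
- rewrite addr_ge0// divr_ge0//; last by rewrite mulr_ge0// ltW.
  by rewrite mulr_ge0// mulr_ge0// ltW.
- by rewrite mulr_ge0 ?(ltW q0)// divr_ge0 ?ltW.
have -> : q * (b / a) = d%:R * (2 * ((2 * C + 1) * b)) / (r0 / (2 * K) * a) + b / a.
  by rewrite /q; field; rewrite !gt_eqF.
by rewrite lerD2l ler_pdivlMr ?mul1r.
Qed.

Hypotheses (eta_gt0 : 0 < eta) (eta_lt1 : eta < 1).

Lemma dn_packs : exists2 C1 : R, 0 < C1 & forall (U : set E) (r : R),
  (forall x y, U x -> U y -> enorm (x - y) <= r) -> packs N dn C1 d (touches U 0) r.
Proof.
have [C1 C10 C1P] := packing; exists C1 => // U r Ur n a b s a0 ab rb us sP.
apply: (C1P U 0%N n a b s) => // x y Ux Uy.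
exact: le_trans (Ur x y Ux Uy) rb.
Qed.

Definition level (n : nat) : set E :=
  [set x | exists2 w, w \in words N 0 n & (phi_seq 0 w @` X) x].

Lemma closed_level n : closed (level n).
Proof.
have -> : level n = \bigcup_(w in [set` words N 0 n]) (phi_seq 0 w @` X).
  by apply/seteqP; split => x [w ww xw]; exists w.
apply: closed_bigcup; first exact: finite_seq.
move=> w /=; rewrite mem_words => /andP[vw _]; apply: compact_closed.
  exact: norm_hausdorff.
apply: continuous_compact cX; apply: continuous_in_subspaceT => x; rewrite inE => Xx.
have [_ hd _ _] := phi_seq_map vw.
by have := differentiable_continuous (hd _ (XV Xx)).
Qed.

Lemma level_sub n : level n `<=` X.
Proof.
by move=> _ [w + [x Xx <-]]; rewrite mem_words => /andP[vw _]; exact: phi_seq_X.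
Qed.

Lemma level_antitone m n : (m <= n)%N -> level n `<=` level m.
Proof.
move=> mn _ [w + [x Xx <-]]; rewrite mem_words => /andP[vw /eqP sw].
move: (vw); rewrite -{1}(cat_take_drop m w) valid_cat => /andP[vt vd].
exists (take m w); first by rewrite mem_words vt size_takel ?sw /=.
exists (phi_seq (0 + size (take m w)) (drop m w) x); first exact: phi_seq_X.
by rewrite -[in RHS](cat_take_drop m w) phi_seq_cat.
Qed.

Lemma frostman_hausdorff_measure (C1 s s' : R) :
  (forall (U : set E) (r : R), (forall x y, U x -> U y -> enorm (x - y) <= r) ->
     packs N dn C1 d (touches U 0) r) ->
  frostman N dn C1 d s -> 0 <= s' -> s' <= s ->
  hausdorff_measure s' (\bigcap_n level n) <> 0%E.
Proof.
move=> dnP [t [C [C0 Z0 frost]]] s0 ss.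
(* A word counts as soon as its piece touches [U]; hence in a cover of [level n] every word is
   counted, already through the image of [x0]. *)
pose mu n (U : set E) : R :=
  (\sum_(w <- words N 0 n | touches U 0 w) dn 0 w `^ t) / partition_sum N dn t 0 n.
apply: (@mass_distribution R d X _ level mu C s s') => //.
- exact: closed_level.
- exact: level_sub.
- exact: level_antitone.
- move=> n; rewrite /mu big1 ?mul0r// => w; rewrite /touches => /asboolP[x _ []].
- move=> n m U cov; rewrite /mu -mulr_suml ler_pdivlMr// mul1r.
  apply: (@sum_cover R _ (words N 0 n) xpredT m (fun i w => touches (U i) 0 w)).
    by move=> w _; exact: powR_ge0.
  move=> w ww _; have [|i im Ui] := cov (phi_seq 0 w x0).
    by exists w => //; exists x0.
  by exists i => //; apply/asboolP; exists x0.
move=> U r r01 Ur; have [|n0 n0P] := frost r (touches U 0) r01 (dnP U r Ur).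
  by move=> u v uv; exact: touches_cat.
by exists n0 => n /n0P; rewrite /mu ler_pdivrMr.
Qed.

Variables (A Cn : R).
Hypotheses (A0 : 0 < A) (Cn0 : 0 < Cn).
Hypothesis N_growth : forall j, (0 < j)%N -> (N j)%:R <= Cn * expR (A * j%:R).

Lemma positive_pressure_dimension (Cr t eps c : R) : 0 < Cr ->
  (forall k i j, (i < N k.+1)%N -> (j < N k.+1)%N ->
    Dnorm X (phi k.+1 j) <= Cr * expR (A * k.+1%:R) * Dnorm X (phi k.+1 i)) ->
  0 < t -> 0 < eps -> 0 < c ->
  (forall k, c * expR (eps * k%:R) <= partition_sum N dn t 0 k) ->
  exists2 s : R, 0 < s & forall s', 0 <= s' -> s' <= s ->
    hausdorff_measure s' (\bigcap_n level n) <> 0%E.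
Proof.
move=> Cr0 ratio t0 eps0 c0 cZ; have [C1 C10 dnP] := dn_packs.
have [s s0 sP] : exists2 s : R, 0 < s & frostman N dn C1 d s.
  apply: (frostman_positive K1 dn_gt0 dn_nil dn_cat_le dn_cat_ge eta_gt0 eta_lt1 dn_le_eta
    d C10 A0 Cn0 N_growth Cr0 ratio t0 eps0 c0 cZ).
by exists s => // s' s'0 s's; exact: frostman_hausdorff_measure sP s'0 s's.
Qed.

Lemma full_pressure_dimension :
  (forall t : R, 0 <= t -> t < d%:R ->
     exists2 c : R, 0 < c & forall k, c <= partition_sum N dn t 0 k) ->
  forall s : R, 0 <= s -> s < d%:R -> hausdorff_measure s (\bigcap_n level n) <> 0%E.
Proof.
move=> cZ s s0 sd; have [C1 C10 dnP] := dn_packs.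
apply: (frostman_hausdorff_measure dnP _ s0 (lexx s)).
exact: (frostman_full K1 dn_gt0 dn_nil dn_cat_le dn_cat_ge eta_gt0 eta_lt1 dn_le_eta
    C10 A0 Cn0 N_growth d_gt0 cZ s0 sd).
Qed.

End System.

(** * The limit set and the pressure *)

Section WordsAsSequences.
Variables (R : realType) (d : nat).
Local Notation E := 'rV[R]_d.
Variables (X : set E) (N : nat -> nat) (phi : nat -> nat -> E -> E).

(** The default 0 is never read by [seq_of_word], which stops at [n]. *)
Definition letter n (w : word N n) (j : nat) : nat :=
  if insub j is Some i then val (w i) else 0%N.

Definition seq_of_word n (w : word N n) : seq nat := mkseq (letter w) n.

Lemma letterE n (w : word N n) (i : 'I_n) : letter w i = w i.
Proof. by rewrite /letter valK. Qed.

Lemma seq_of_word_inj n : injective (@seq_of_word n).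
Proof.
move=> u v uv; apply/ffunP => i; apply: val_inj; rewrite /= -!letterE.
by have := congr1 (fun s => nth 0%N s i) uv; rewrite !nth_mkseq.
Qed.

Lemma valid_nthP k v : (forall j, (j < size v)%N -> (nth 0%N v j < N (k + j).+1)%N) ->
  valid N k v.
Proof.
elim: v k => //= i v IH k h; apply/andP; split; first by have := h 0%N isT; rewrite addn0.
by apply: IH => j jv; have := h j.+1 jv; rewrite addnS.
Qed.

Lemma seq_of_word_in n (w : word N n) : seq_of_word w \in words N 0 n.
Proof.
rewrite mem_words size_mkseq eqxx andbT; apply: valid_nthP => j; rewrite size_mkseq => jn.
rewrite nth_mkseq// add0n; have := letterE w (Ordinal jn) => /= ->; exact: ltn_ord.
Qed.

Lemma seq_of_word_surj n v : v \in words N 0 n -> exists w : word N n, seq_of_word w = v.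
Proof.
rewrite mem_words => /andP[vv /eqP sv].
have lt (j : 'I_n) : (nth 0%N v j < N j.+1)%N.
  by have := @valid_nth N 0 v j vv; rewrite add0n; apply; rewrite sv.
exists [ffun j : 'I_n => Ordinal (lt j)].
apply: (@eq_from_nth _ 0%N); rewrite size_mkseq ?sv// => j jn.
rewrite nth_mkseq//; have := letterE [ffun j : 'I_n => Ordinal (lt j)] (Ordinal jn) => /= ->.
by rewrite ffunE.
Qed.

Lemma phi_word_seq n (w : word N n) : phi_word phi w = phi_seq phi 0 (seq_of_word w).
Proof.
rewrite phi_seq_comp_range size_mkseq add0n big_add1 big_mkord.
by apply: eq_bigr => j _; rewrite subn1 /= nth_mkseq// letterE.
Qed.

(** [seq_of_word] is a bijection onto [words N 0 n]. *)
Lemma Zfun_partition_sum n (t : R) : Zfun X N phi n t = partition_sum N (dn X phi) t 0 n.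
Proof.
rewrite /Zfun /partition_sum.
have P : perm_eq [seq seq_of_word w | w <- index_enum (word N n)] (words N 0 n).
  apply: uniq_perm; first by rewrite map_inj_uniq ?index_enum_uniq//; exact: seq_of_word_inj.
    exact: words_uniq.
  move=> v; apply/mapP/idP => [[w _ ->]|/seq_of_word_surj[w <-]]; first exact: seq_of_word_in.
  by exists w => //; rewrite mem_index_enum.
rewrite -[RHS](perm_big _ P).
by rewrite big_map; apply: eq_bigr => w _; rewrite phi_word_seq.
Qed.

Lemma limit_set_level : limit_set X N phi = \bigcap_n level X N phi n.
Proof.
apply/seteqP; split => x h n _; have := h n I.
  by case=> w; rewrite phi_word_seq => xw; exists (seq_of_word w) => //; exact: seq_of_word_in.
by case=> v /seq_of_word_surj[w <-] xw; exists w; rewrite phi_word_seq.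
Qed.

End WordsAsSequences.

(** * From upper and lower limits to exponential bounds *)

Section ExponentialGrowth.
Variable R : realType.

Lemma eventually_bounded (x : nat -> R) (b : R) (n1 : nat) : (forall n, 0 <= x n) ->
  (forall n, (n1 <= n)%N -> x n <= b) -> exists2 C : R, 0 < C & forall n, x n <= C.
Proof.
move=> x0 xb; exists (1 + `|b| + \sum_(i < n1) x i).
  by rewrite ltr_wpDr ?sumr_ge0// ltr_pwDl.
move=> n; have [nn|nn] := leqP n1 n.
  apply: le_trans (xb n nn) _; apply: le_trans (ler_norm b) _.
  by rewrite -addrA addrCA lerDl addr_ge0// sumr_ge0.
rewrite (bigD1 (Ordinal nn))//= addrCA lerDl !addr_ge0//.
by apply: sumr_ge0.
Qed.

(** Every rate [b >= a] is allowed, so that [N] and [rho] can later share one exponent. *)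
Lemma limn_esup_growth (x : nat -> R) : (forall n, 0 <= x n) ->
  (limn_esup (fun n => (ln (x n) / n%:R)%:E) < +oo)%E ->
  exists a : R, forall b, a <= b ->
    exists2 C : R, 0 < C & forall n, x n <= C * expR (b * n%:R).
Proof.
move=> x0 /ereal_inf_lt[_ [V [n1 _ VP] <-] supV].
have [a aP] : exists a : R, forall n, (n1 <= n)%N -> ln (x n) / n%:R <= a.
  have ub n : (n1 <= n)%N ->
      ((ln (x n) / n%:R)%:E <= ereal_sup ((fun n => (ln (x n) / n%:R)%:E) @` V))%E.
    by move=> nn; apply: ereal_sup_ubound; exists n => //; exact: VP.
  move: supV ub; case: ereal_sup => [a| |] //= _ ub.
    by exists a => n /ub; rewrite lee_fin.
  by exists 0 => n /ub.
exists a => b ab.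
have [||C C0 CP] := @eventually_bounded (fun n => x n / expR (b * n%:R)) 1 (maxn n1 1).
- by move=> n; rewrite divr_ge0// expR_ge0.
- move=> n; rewrite geq_max => /andP[/aP h n0].
  rewrite ler_pdivrMr ?expR_gt0// mul1r.
  (* [ln 0] is 0 by convention and carries no information about [x n]. *)
  have [->|xn] := eqVneq (x n) 0; first exact: expR_ge0.
  rewrite -[leLHS]lnK ?posrE ?lt_neqAle ?x0 1?eq_sym ?xn// ler_expR.
  by rewrite -ler_pdivrMr ?ltr0n// (le_trans h).
by exists C => // n; rewrite -ler_pdivrMr ?expR_gt0//; exact: CP.
Qed.

(** Stated for nonnegative sequences so that it also covers the vanishing sums of dimension 0. *)
Lemma limn_einf_growth (z : nat -> R) : (forall n, 0 <= z n) ->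
  (0 < limn_einf (fun n => (ln (z n) / n%:R)%:E))%E ->
  exists eps : R, 0 < eps /\ exists n1, forall n, (n1 <= n)%N ->
    (0 < n)%N /\ eps * n%:R <= ln (z n).
Proof.
move=> z0; rewrite /limn_einf oppe_gt0.
move=> /ereal_inf_lt[_ [V [n1 _ VP] <-] supV].
have ub n : (n1 <= n)%N ->
    ((- (ln (z n) / n%:R))%:E <= ereal_sup ((\- (fun n => (ln (z n) / n%:R)%:E))%E @` V))%E.
  by move=> nn; apply: ereal_sup_ubound; exists n => //; exact: VP.
have [eps eps0 epsP] : exists2 eps : R, 0 < eps &
    forall n, (n1 <= n)%N -> eps <= ln (z n) / n%:R.
  move: supV ub; case: ereal_sup => [a| |] //= a0 ub.
    exists (- a); first by rewrite oppr_gt0 -lte_fin.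
    by move=> n /ub; rewrite lee_fin lerNl.
  by exists 1 => // n /ub.
exists eps; split => //; exists (maxn n1 1) => n; rewrite geq_max => /andP[/epsP h n0].
by split => //; rewrite -ler_pdivlMr ?ltr0n.
Qed.

Lemma positive_growth (z : nat -> R) : (forall n, 0 < z n) ->
  (0 < limn_einf (fun n => (ln (z n) / n%:R)%:E))%E ->
  exists eps c : R, [/\ 0 < eps, 0 < c & forall n, c * expR (eps * n%:R) <= z n].
Proof.
move=> z0 /(limn_einf_growth (fun n => ltW (z0 n)))[eps [eps0 [n1 zP]]].
have [||C C0 CP] := @eventually_bounded (fun n => expR (eps * n%:R) / z n) 1 n1.
- by move=> n; rewrite divr_ge0 ?expR_ge0// ltW.
- move=> n /zP[_ h]; rewrite ler_pdivrMr// mul1r -[leRHS]lnK ?posrE//.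
  by rewrite ler_expR.
exists eps, C^-1; split; rewrite ?invr_gt0// => n.
by rewrite ler_pdivrMl// -ler_pdivrMr//; exact: CP.
Qed.

End ExponentialGrowth.

(** The hypotheses on the system are turned into the constants of the abstract estimates, and the
    conclusions are restated for [Zfun] and [limit_set]. *)
Lemma NCIFS_dimension (R : realType) (d : nat) (X : set 'rV[R]_d)
    (N : nat -> nat) (phi : nat -> nat -> 'rV[R]_d -> 'rV[R]_d) :
  admissible_X X -> X !=set0 ->
  finite_NCIFS X N phi ->
  (limn_esup (fun n => (ln ((N n)%:R : R) / n%:R)%:E) < +oo)%E ->
  (limn_esup (fun n => (ln (rho X N phi n) / n%:R)%:E) < +oo)%E ->
  (0 < d)%N ->
  [/\ forall n t, 0 < Zfun X N phi n t,
      forall n t t', t <= t' -> Zfun X N phi n t' <= Zfun X N phi n t,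
      forall t eps c : R, 0 < t -> 0 < eps -> 0 < c ->
        (forall n, c * expR (eps * n%:R) <= Zfun X N phi n t) ->
        exists2 s : R, 0 < s & forall s', 0 <= s' -> s' <= s ->
          hausdorff_measure s' (limit_set X N phi) <> 0%E
    & (forall t : R, 0 <= t -> t < d%:R ->
         exists2 c : R, 0 < c & forall n, c <= Zfun X N phi n t) ->
      forall s : R, 0 <= s -> s < d%:R ->
        hausdorff_measure s (limit_set X N phi) <> 0%E].
Proof.
move=> [cX Xcl _] [p Xp] [Npos phiX osc [V [oV cV XV phiV [K K1 dist]]] [eta0 eta1 contr]] Ngr rgr d_gt0.
have [x0 ix0] : interior X !=set0.
  apply/set0P/eqP => iX; move: Xp; rewrite Xcl iX closure0.
  by [].
have [r0 r0_gt0 x0_ball] : exists2 r : R, 0 < r & forall x, enorm (x - x0) <= r -> interior X x.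
  have /nbhs_enormP[r r_gt0 rX] : nbhs x0 (interior X).
    by apply: open_nbhs_nbhs; split => //; exact: open_interior.
  exists (r / 2); first by rewrite divr_gt0.
  by move=> x xr; apply: rX; apply: le_lt_trans xr _; lra.
have phiM j i (j1 : (1 <= j)%N) (iN : (i < N j)%N) : conformal_map V (phi j i).
  by apply: conformal_C1_diffeo_map => //; exact: phiV.
(* The given bound may be too small for [ln eta] to make sense; raising it to at least 1/2 keeps it
   below 1. *)
pose eta := Num.max eta0 2^-1.
have eta_gt0 : 0 < eta by rewrite lt_max invr_gt0 ltr0n orbT.
have eta_lt1 : eta < 1 by rewrite gt_max eta1 /= invf_lt1 ?ltr1n.
have contr' j i (j1 : (1 <= j)%N) (iN : (i < N j)%N) : Dnorm X (phi j i) <= eta.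
  by rewrite le_max contr.
have dpos := @dn_gt0 R d X V N phi K d_gt0 XV phiM K1 dist x0 r0 r0_gt0 x0_ball.
have D0 k i : (i < N k.+1)%N -> 0 < Dnorm X (phi k.+1 i).
  by move=> iN; have := dpos k [:: i]; rewrite /= iN => /(_ isT).
have [a1 a1P] := limn_esup_growth (fun n => ler0n _ (N n)) Ngr.
have rho0 n : 0 <= rho X N phi n.
  by apply/bigmax_geP; left.
have [a2 a2P] := limn_esup_growth rho0 rgr.
(* One positive rate that dominates both growth hypotheses. *)
pose A := 1 + `|a1| + `|a2|.
have A0 : 0 < A by rewrite /A -addrA ltr_pwDl// addr_ge0.
have [Cn Cn0 CnP] : exists2 C : R, 0 < C & forall n, (N n)%:R <= C * expR (A * n%:R).
  apply: a1P; apply: le_trans (ler_norm _) _; rewrite /A.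
  have := normr_ge0 a2; lra.
have [Cr Cr0 CrP] : exists2 C : R, 0 < C & forall n, rho X N phi n <= C * expR (A * n%:R).
  apply: a2P; apply: le_trans (ler_norm _) _; rewrite /A.
  have := normr_ge0 a1; lra.
have ratio k i j : (i < N k.+1)%N -> (j < N k.+1)%N ->
    Dnorm X (phi k.+1 j) <= Cr * expR (A * k.+1%:R) * Dnorm X (phi k.+1 i).
  move=> iN jN; rewrite -ler_pdivrMr ?D0//; apply: le_trans (CrP k.+1).
  rewrite /rho; apply/bigmax_geP; right; exists (Ordinal jN) => //.
  by apply/bigmax_geP; right; exists (Ordinal iN).
have Ngrowth j : (0 < j)%N -> (N j)%:R <= Cn * expR (A * j%:R) by move=> _; exact: CnP.
have words0 k n : exists w, w \in words N k n.
  elim: n k => [|n IH] k; first by exists [::].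
  have [w ww] := IH k.+1; exists (0%N :: w).
  by move: ww; rewrite !mem_words /= eqSS Npos.
have le1 n w : w \in words N 0 n -> 0 < dn X phi 0 w <= 1.
  rewrite mem_words => /andP[vw _]; rewrite dpos//=.
  have := dn_le_eta d_gt0 phiX XV phiM K1 dist contr' r0_gt0 x0_ball vw.
  by move=> /le_trans; apply; apply: exprn_ile1; exact: ltW.
rewrite limit_set_level; split.
- move=> n t; rewrite Zfun_partition_sum /partition_sum.
  have [w ww] := words0 0%N n.
  rewrite (bigD1_seq w)//=; last exact: words_uniq.
  have /andP[w0 _] := le1 n w ww.
  by apply: ltr_wpDr; [apply: sumr_ge0 => v _; exact: powR_ge0|exact: powR_gt0].
- move=> n t t' tt; rewrite !Zfun_partition_sum /partition_sum big_seq [leRHS]big_seq.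
  by apply: ler_sum => w /le1 h; rewrite ger_powR.
- move=> t eps c t0 eps0 c0 cZ.
  apply: (@positive_pressure_dimension R d X V N phi K eta d_gt0 phiX osc oV cV XV cX phiM K1
    dist contr' x0 r0 r0_gt0 x0_ball eta_gt0 eta_lt1 A Cn A0 Cn0 Ngrowth Cr t eps c) => //.
  by move=> k; have := cZ k; rewrite Zfun_partition_sum.
- move=> cZ; apply: (@full_pressure_dimension R d X V N phi K eta d_gt0 phiX osc oV cV XV cX
    phiM K1 dist contr' x0 r0 r0_gt0 x0_ball eta_gt0 eta_lt1 A Cn A0 Cn0 Ngrowth).
  move=> t t0 td; have [c c0 cP] := cZ t t0 td; exists c => // k.
  by have := cP k; rewrite Zfun_partition_sum.
Qed.

(** * Boundedness, dimension zero and the conclusion *)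

Lemma compact_enorm_bounded (R : realType) (d : nat) (X : set 'rV[R]_d) : compact X ->
  exists2 a : R, 0 < a & forall x, X x -> enorm (x - 0) <= a.
Proof.
move=> cX; have [X0|/set0P X0] := eqVneq X set0; first by exists 1 => // x; rewrite X0.
have [|c _ cP] := @compact_EVT_max _ _ (fun x : 'rV[R]_d => enorm (x - 0)) X X0 cX.
  by apply: continuous_subspaceT; exact: enorm_continuous.
exists (1 + enorm (c - 0)); first by rewrite ltr_pwDl ?enorm_ge0.
by move=> x Xx; apply: le_trans (cP x _) _; [rewrite inE|rewrite lerDr].
Qed.

(** In dimension 0 all derivative norms are 0, and so are their powers with exponent [t != 0]. *)
Lemma Zfun_dim0 (R : realType) (X : set 'rV[R]_0) N phi n (t : R) :
  X !=set0 -> t != 0 -> Zfun X N phi n t = 0.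
Proof.
move=> [p Xp] t0; rewrite /Zfun big1// => w _.
have e0 (v : 'rV[R]_0) : enorm v = 0 by rewrite /enorm big_ord0 sqrtr0.
have d0 x : dnorm (phi_word phi w) x = 0.
  rewrite /dnorm (_ : [set _ | _ in _] = [set 0]) ?sup1//.
  apply/seteqP; split => [_ [v _ <-]|_ ->]; first exact: e0.
  by exists 0; rewrite /= e0.
rewrite /Dnorm (_ : [set _ | _ in _] = [set 0]) ?sup1 ?powR0//.
by apply/seteqP; split => [_ [v _ <-]|_ ->]; [exact: d0|exists p].
Qed.

(** Only [t = 0] can then have positive pressure, so the supremum is 0 whether or not the set is
    empty. *)
Lemma Bowen_param_eq0 (R : realType) (d : nat) (X : set 'rV[R]_d) N phi :
  (forall t, 0 < t -> (lower_pressure X N phi t <= 0)%E) -> Bowen_param X N phi = 0%E.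
Proof.
move=> P0; rewrite /Bowen_param; case: asboolP => // /eqP/set0P[_ [t [t0 tP] _]].
have t_eq0 u : 0 <= u -> (0 < lower_pressure X N phi u)%E -> u = 0.
  rewrite le_eqVlt => /orP[/eqP//|/P0 h1 h2]; move: (lt_le_trans h2 h1).
  by rewrite ltxx.
apply/eqP; rewrite eq_le; apply/andP; split.
  by apply: ge_ereal_sup => _ [u [u0 uP] <-]; rewrite (t_eq0 u u0 uP).
by apply: ereal_sup_ubound; exists t => //; rewrite (t_eq0 t t0 tP).
Qed.

Theorem theorem4p6 (R : realType) (d : nat) (X : set 'rV[R]_d)
    (N : nat -> nat) (phi : nat -> nat -> 'rV[R]_d -> 'rV[R]_d) :
  admissible_X X -> X !=set0 ->
  finite_NCIFS X N phi ->
  (limn_esup (fun n => (ln ((N n)%:R : R) / n%:R)%:E) < +oo)%E ->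
  (limn_esup (fun n => (ln (rho X N phi n) / n%:R)%:E) < +oo)%E ->
  (hausdorff_dim (limit_set X N phi) = 0%E -> Bowen_param X N phi = 0%E) /\
  (Bowen_param X N phi = (d%:R)%:E -> hausdorff_dim (limit_set X N phi) = (d%:R)%:E).
Proof.
move=> aX X0 sys Ngr rgr.
have dim_lb (s : R) : (forall s', 0 <= s' -> s' < s ->
      hausdorff_measure s' (limit_set X N phi) <> 0%E) ->
    (s%:E <= hausdorff_dim (limit_set X N phi))%E.
  move=> h; apply: le_ereal_inf_tmp => _ [s' [s'0 s'P] <-].
  by rewrite lee_fin leNgt; apply/negP => s's; exact: (h s').
have dim_ub : (hausdorff_dim (limit_set X N phi) <= d%:R%:E)%E.
  have [cX _ _] := aX; have [a a0 aP] := compact_enorm_bounded cX.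
  apply: (hausdorff_dim_le a0) => x /(_ 0%N I)[w [y Xy]].
  by rewrite /phi_word big_ord0 => <-; exact: aP.
split.
  move=> HD0; apply: Bowen_param_eq0 => t t0; rewrite leNgt; apply/negP => Pt.
  (* In dimension 0 the logarithms are [ln 0 = 0], which contradicts their linear growth. *)
  case: (posnP d) => [d0|d_gt0].
    subst d; have Z0 n : 0 <= Zfun X N phi n t by rewrite Zfun_dim0 ?gt_eqF.
    have [eps [eps0 [n1 h]]] := limn_einf_growth Z0 Pt.
    have [n0] := h n1 (leqnn _); rewrite Zfun_dim0 ?gt_eqF// ln0//.
    by rewrite leNgt mulr_gt0// ltr0n.
  have [Zpos _ pos _] := NCIFS_dimension aX X0 sys Ngr rgr d_gt0.
  have [eps [c [eps0 c0 cZ]]] := positive_growth (fun n => Zpos n t) Pt.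
  have [s s0 sP] := pos t eps c t0 eps0 c0 cZ.
  have := dim_lb s (fun s' h0 h1 => sP s' h0 (ltW h1)).
  by rewrite HD0 lee_fin leNgt s0.
move=> Bd; apply/eqP; rewrite eq_le dim_ub /=.
case: (posnP d) => [d0|d_gt0]; first by rewrite (_ : d%:R = 0 :> R) ?hausdorff_dim_ge0// d0.
have [Zpos Zmono _ full] := NCIFS_dimension aX X0 sys Ngr rgr d_gt0.
apply: dim_lb => s s0 sd; apply: full => // t t_ge0 td.
(* [B = d > t] provides [u > t] with positive pressure; [Z_n(u)] is bounded below, and [Z_n]
   decreases in the exponent. *)
have [u [_ uP] tu] : exists2 u : R, 0 <= u /\ (0 < lower_pressure X N phi u)%E & t < u.
  move: Bd; rewrite /Bowen_param; case: asboolP => _.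
    by move=> [] /esym/eqP; rewrite pnatr_eq0 gtn_eqF.
  move=> Bd; move: td; rewrite -lte_fin -Bd => /ereal_sup_gt[_ [u uS <-]].
  by rewrite lte_fin => tu; exists u.
have [eps [c [eps0 c0 cZ]]] := positive_growth (fun n => Zpos n u) uP.
exists c => // n; apply: le_trans (Zmono n t u (ltW tu)); apply: le_trans (cZ n).
by rewrite ler_peMr ?(ltW c0)// -[leLHS]expR0 ler_expR mulr_ge0// ltW.
Qed.
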